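(* Consider the continuous one-dimensional circle model with $N$ drivers described in the context. If the vector $S=(s_1,\dots,s_N)$ of driver positions follows a uniform distribution (each of its coordinates is uniformly and independently drawn from $[0,1]$), and $\ell(S)$ denotes the corresponding vector of gap lengths, then $$\mathbb{E}_\ell\big[\Delta V(\ell(S))\big]>0,$$ where $\mathbb{E}_\ell[\cdot]$ means that the expectation is taken over $\ell=\ell(S)$, i.e. over the gap vector induced by the random positions $S$.
   Context: Continuous circle model: the space is the circle of length 1, i.e. $[0,1]$ with $0$ and $1$ identified and distance $d(u,v)=\min(|v-u|,1-|v-u|)$. There are $N$ drivers, whose positions, after sorting (relabelling the indices), are $s_1\le s_2\le\dots\le s_N$. For $k=1,\dots,N$, with the convention $s_{N+1}=s_1$, the gap $\ell_k$ is the length of the interval (arc) $I_k$ between the two consecutive drivers $s_k$ and $s_{k+1}$, going from $s_k$ in increasing direction around the circle (so $\ell_k=s_{k+1}-s_k$ for $k<N$ and $\ell_N=1-s_N+s_1$; hence $\ell_k\ge0$ and $\sum_k\ell_k=1$). The gap vector is $\ell(S)=(\ell_1,\dots,\ell_N)$ and $V(\ell)=\sum_{k=1}^N\ell_k^2$. One step of the dynamics: a user appears at a uniformly distributed point of the circle and is assigned to the closest driver; that driver is removed and is replaced by a new driver located at an independent uniformly distributed point of the circle. Let $\ell'$ be the gap vector (after re-sorting) of the resulting configuration of $N$ drivers. Define $\Delta V(\ell)=\mathbb{E}\big[V(\ell')-V(\ell)\,\big|\,\ell\big]$, the expectation being over the positions of the new user and the new driver.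
   Formalization: The formal theorem assumes at least three drivers (N ≥ 3); for N = 1, V is constantly 1, and for N = 2 the configuration after one step is again two independent uniform points, so the expectation is 0 and the strict inequality fails. *)

(* Defs.v *)
From HB Require Import structures.
From mathcomp Require Import all_boot all_order all_algebra.
From mathcomp Require Import all_classical all_reals all_analysis.

Set Implicit Arguments.
Unset Strict Implicit.
Unset Printing Implicit Defensive.

Import Order.TTheory GRing.Theory Num.Theory.
Import numFieldNormedType.Exports.

Local Open Scope classical_set_scope.
Local Open Scope ring_scope.

(* A point of the circle of length 1 is represented by a real in [0, 1]. *)
Definition circle_dist (R : realType) (u v : R) : R :=
  Num.min `|v - u| (1 - `|v - u|).

(* The sorted positions t are indexed from 0, so the last gap, from t_(N-1)
   through the point 0 = 1 to t_0, is the one of index N - 1. *)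
Definition gaps (R : realType) (N : nat) (s : N.-tuple R) : N.-tuple R :=
  let t := sort <=%R s in
  [tuple if (k.+1 < N)%N then t`_k.+1 - t`_k else 1 - t`_k + t`_0 | k < N].

Definition V (R : realType) (N : nat) (l : N.-tuple R) : R :=
  \sum_(k < N) tnth l k ^+ 2.

(* Ties are broken arbitrarily. Drivers at distinct points tie only for finitely
   many u, and choosing among drivers at the same point of the circle does not affect
   [V (gaps (step s u w))]. The result is [None] only if N = 0. *)
Definition closest (R : realType) (N : nat) (s : N.-tuple R) (u : R)
    : option 'I_N :=
  [pick k | [forall j, circle_dist u (tnth s k) <= circle_dist u (tnth s j)]].

(* New configuration when the user appears at u and the new driver at w. *)
Definition step (R : realType) (N : nat) (s : N.-tuple R) (u w : R)
    : N.-tuple R :=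
  [tuple if closest s u == Some k then w else tnth s k | k < N].

Definition unif01 (R : realType) : probability (measurableTypeR R) R :=
  uniform_prob (@ltr01 R).

(* The configuration with gap vector l that has its first driver at 0; all the
   configurations with gap vector l are rotations of it. *)
Definition config_of_gaps (R : realType) (N : nat) (l : N.-tuple R)
    : N.-tuple R :=
  [tuple \sum_(i < N | (i < k)%N) tnth l i | k < N].

(* E[V(l') - V(l) | l]: the user and the new driver are independent and uniform.
   As both are uniform on the circle, the choice of a configuration with gap
   vector l is immaterial. *)
Definition deltaV (R : realType) (N : nat) (l : N.-tuple R) : R :=
  \int[(unif01 R \x unif01 R)%E]_uw
    (V (gaps (step (config_of_gaps l) uw.1 uw.2)) - V l).

Definition mutually_independent (d : measure_display) (T : measurableType d)
    (R : realType) (P : probability T R) (I : finType) (X : I -> {RV P >-> R}) :=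
  forall (J : {set I}) (A : I -> set R), (forall i, measurable (A i)) ->
    P (\bigcap_(i in [set` J]) X i @^-1` A i)
    = (\prod_(i in J) P (X i @^-1` A i))%E.

Lemma config_of_gapsK (R : realType) (N : nat) (l : N.-tuple R) :
  (forall k, 0 <= tnth l k) -> \sum_(k < N) tnth l k = 1 ->
  gaps (config_of_gaps l) = l.
Proof.
move=> l0 l1.
have nthc (k : nat) : (k < N)%N ->
    (config_of_gaps l)`_k = \sum_(i < N | (i < k)%N) tnth l i.
  by move=> kN; rewrite -(tnth_nth 0 _ (Ordinal kN)) tnth_mktuple.
have sumS (k : 'I_N) : \sum_(i < N | (i < k.+1)%N) tnth l i =
    \sum_(i < N | (i < k)%N) tnth l i + tnth l k.
  rewrite (bigD1 k)//= addrC; congr (_ + _); apply: eq_bigl => i.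
  by rewrite ltnS [in RHS]ltn_neqAle andbC.
have srt : sort <=%R (config_of_gaps l) = config_of_gaps l.
  apply/sorted_sort; first exact: le_trans.
  apply/(sortedP 0) => i; rewrite size_tuple => iN.
  rewrite !nthc ?(ltnW iN)// (sumS (Ordinal (ltnW iN))).
  by rewrite lerDl.
apply: eq_from_tnth => k; rewrite tnth_mktuple srt.
case: ifPn => [kN|].
  by rewrite !nthc// ?(ltnW kN)// sumS addrC addKr.
rewrite -leqNgt => Nk.
have N0 : (0 < N)%N by exact: leq_ltn_trans (ltn_ord k).
rewrite !nthc// [X in _ + X]big_pred0// addr0 -l1.
rewrite (_ : \sum_(i < N) tnth l i = \sum_(i < N | (i < k.+1)%N) tnth l i).
  by rewrite sumS addrC addKr.
by apply: eq_bigl => i; rewrite (leq_trans (ltn_ord i) Nk).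
Qed.

(* Main.v *)
(** Let m(s, z) be the distance from z, in the increasing direction, to the
next driver of s, and let m_k be the same function once driver k is removed.
Then V(gaps s) = 2 int m dz, and removing a driver whose neighbouring gaps are a
and b changes int m, int m^2 and int m^3 by ab, ab(a + b) and
a^3 b + (3/2) a^2 b^2 + a b^3.  Driver k is the closest one with probability
(a + b)/2, and inserting a uniform point turns 2 int m_k into 2 int m_k - int m_k^2,
so that
  Delta V = sum_k (a + b)/2 * (2ab - ab(a + b)) - int m^2.
Since 2 a^2 b^2 <= a^3 b + a b^3, the k-th term is at least
ab(a + b) - (4/7) (a^3 b + (3/2) a^2 b^2 + a b^3), hence
  Delta V >= sum_k int ((m_k^2 - m^2) - (4/7) (m_k^3 - m^3)) - int m^2.
For fixed z, the distances from z to n independent uniform drivers are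
independent and uniform, so that E m^2 = 2/((n+1)(n+2)) and
E m^3 = 6/((n+1)(n+2)(n+3)); the expectation of the lower bound is
(14 N - 30)/(7 (N+1)(N+2)(N+3)), which is positive for N > 2.  The order
statistics and the joint law of the gaps are never needed. *)

Require Import Defs.
From HB Require Import structures.
From mathcomp Require Import all_boot all_order all_algebra.
From mathcomp Require Import fingroup perm.
From mathcomp Require Import all_classical all_reals all_analysis.
From mathcomp Require Import measurable_realfun.
From mathcomp Require Import ring lra.

Set Implicit Arguments.
Unset Strict Implicit.
Unset Printing Implicit Defensive.

Import Order.TTheory GRing.Theory Num.Theory.
Import numFieldNormedType.Exports.

Local Open Scope classical_set_scope.
Local Open Scope ring_scope.

(** * Bounded measurable functions on probability spaces *)

(** On a probability space these functions are integrable and, unlike integrable ones, they are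
    closed under products, sections and partial integration. The integrability side conditions below
    are discharged from this property. *)
Definition bounded_measurable d (T : measurableType d) (R : realType)
    (f : T -> R) :=
  measurable_fun setT f /\ exists M, forall x, `|f x| <= M.

Section bounded_measurable_closure.
Context d (T : measurableType d) (R : realType).
Implicit Types f g : T -> R.

Lemma bounded_measurable_cst (c : R) :
  bounded_measurable (fun _ : T => c).
Proof. by split; [exact: measurable_cst|exists `|c|]. Qed.

Lemma bounded_measurableD f g : bounded_measurable f -> bounded_measurable g ->
  bounded_measurable (fun x => f x + g x).
Proof.
move=> [mf [M fM]] [mg [K gK]]; split; first exact: measurable_funD.
by exists (M + K) => x; rewrite (le_trans (ler_normD _ _))// lerD.
Qed.

Lemma bounded_measurableM f g : bounded_measurable f -> bounded_measurable g ->
  bounded_measurable (fun x => f x * g x).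
Proof.
move=> [mf [M fM]] [mg [K gK]]; split; first exact: measurable_funM.
by exists (M * K) => x; rewrite normrM ler_pM.
Qed.

Lemma bounded_measurableZ (c : R) f : bounded_measurable f ->
  bounded_measurable (fun x => c * f x).
Proof. exact/bounded_measurableM/bounded_measurable_cst. Qed.

Lemma bounded_measurableB f g : bounded_measurable f -> bounded_measurable g ->
  bounded_measurable (fun x => f x - g x).
Proof.
move=> [mf [M fM]] [mg [K gK]]; split; first exact: measurable_funB.
by exists (M + K) => x; rewrite (le_trans (ler_normB _ _))// lerD.
Qed.

Lemma bounded_measurableX n f : bounded_measurable f ->
  bounded_measurable (fun x => f x ^+ n).
Proof.
move=> bf; elim: n => [|n ih]; first exact: bounded_measurable_cst.
by under eq_fun do rewrite exprS; exact: bounded_measurableM.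
Qed.

Lemma bounded_measurable_min f g :
  bounded_measurable f -> bounded_measurable g ->
  bounded_measurable (fun x => Num.min (f x) (g x)).
Proof.
move=> [mf [M fM]] [mg [K gK]]; split; first exact: measurable_minr.
exists (Num.max M K) => x; rewrite le_max.
by case: (leP (f x) (g x)) => _; rewrite ?fM ?gK ?orbT.
Qed.

Lemma bounded_measurable_sum (I : Type) (r : seq I) (Q : pred I)
    (F : I -> T -> R) : (forall i, bounded_measurable (F i)) ->
  bounded_measurable (fun x => \sum_(i <- r | Q i) F i x).
Proof.
move=> bF; elim: r => [|i r ih].
  by under eq_fun do rewrite big_nil; exact: bounded_measurable_cst.
case: (boolP (Q i)) => Qi.
  by under eq_fun do rewrite big_cons Qi; exact: bounded_measurableD.
by under eq_fun do rewrite big_cons (negbTE Qi).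
Qed.

Lemma bounded_measurable_indic (A : set T) : measurable A ->
  bounded_measurable (\1_A : T -> R).
Proof.
move=> mA; split; first exact: measurable_indic.
by exists 1 => x; rewrite indicE; case: (x \in A); rewrite ?normr1 ?normr0 ?ler01.
Qed.

Lemma bounded_measurable_comp d' (T' : measurableType d') (h : T' -> T) f :
  measurable_fun setT h -> bounded_measurable f ->
  bounded_measurable (fun x => f (h x)).
Proof.
move=> mh [mf [M fM]]; split; first exact: measurableT_comp.
by exists M.
Qed.

End bounded_measurable_closure.

Section bounded_measurable_integral.
Context d (T : measurableType d) (R : realType) (P : probability T R).
Implicit Types f g : T -> R.

Lemma bounded_measurable_integrable f : bounded_measurable f ->
  P.-integrable setT (EFin \o f).
Proof.
move=> [mf [M fM]]; apply: measurable_bounded_integrable => //.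
  by rewrite (le_lt_trans (probability_le1 P measurableT))// ltry.
exists M; split; first exact: num_real.
by move=> x Mx y _; apply: le_trans (fM y) (ltW Mx).
Qed.

Lemma bounded_measurable_EFin f : bounded_measurable f ->
  (\int[P]_x (f x)%:E = (\int[P]_x f x)%:E)%E.
Proof.
move=> /bounded_measurable_integrable if_; rewrite /Rintegral fineK//.
exact: integrable_fin_num.
Qed.

Lemma prob_integral_cst (c : R) : \int[P]_x c = c.
Proof. by rewrite Rintegral_cst//= probability_setT mulr1. Qed.

Lemma prob_integralD f g : bounded_measurable f -> bounded_measurable g ->
  \int[P]_x (f x + g x) = \int[P]_x f x + \int[P]_x g x.
Proof. by move=> ? ?; rewrite RintegralD//; exact: bounded_measurable_integrable. Qed.

Lemma prob_integralB f g : bounded_measurable f -> bounded_measurable g ->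
  \int[P]_x (f x - g x) = \int[P]_x f x - \int[P]_x g x.
Proof. by move=> ? ?; rewrite RintegralB//; exact: bounded_measurable_integrable. Qed.

Lemma prob_integralZ (c : R) f : bounded_measurable f ->
  \int[P]_x (c * f x) = c * \int[P]_x f x.
Proof. by move=> ?; rewrite RintegralZl//; exact: bounded_measurable_integrable. Qed.

Lemma prob_integral_sum (I : Type) (r : seq I) (Q : pred I) (F : I -> T -> R) :
  (forall i, bounded_measurable (F i)) ->
  \int[P]_x (\sum_(i <- r | Q i) F i x) = \sum_(i <- r | Q i) \int[P]_x F i x.
Proof.
move=> bF; elim: r => [|i r ih].
  rewrite big_nil -[RHS]prob_integral_cst; apply: eq_Rintegral => x _.
  by rewrite big_nil.
rewrite big_cons -ih; case: (boolP (Q i)) => Qi.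
  rewrite -prob_integralD//; last exact: bounded_measurable_sum.
  by apply: eq_Rintegral => x _; rewrite big_cons Qi.
by apply: eq_Rintegral => x _; rewrite big_cons (negbTE Qi).
Qed.

Lemma prob_integral_indic (A : set T) : measurable A ->
  \int[P]_x \1_A x = fine (P A).
Proof. by move=> mA; rewrite /Rintegral integral_indic// setIT. Qed.

Lemma eq_prob_integral f g : f =1 g -> \int[P]_x f x = \int[P]_x g x.
Proof. by move=> fg; apply: eq_Rintegral => x _. Qed.

End bounded_measurable_integral.

(* No measurability is required: the positive part of the integral is a
   supremum over the simple functions below the integrand. *)
Lemma le_integral_pointwise d (T : measurableType d) (R : realType)
    (mu : {measure set T -> \bar R}) (f g : T -> \bar R) :
  (forall x, f x <= g x)%E -> (\int[mu]_x f x <= \int[mu]_x g x)%E.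
Proof.
move=> fg; rewrite /integral !patch_setT; apply: leeD; last rewrite leeN2;
  apply: ge_ereal_sup => _ [h /= hf <-]; apply: ereal_sup_ubound; exists h => //= x.
  apply: le_trans (hf x) _; rewrite !funeposE.
  by rewrite ge_max !le_max fg lexx orbT.
apply: le_trans (hf x) _; rewrite !funenegE.
by rewrite ge_max !le_max leeN2 fg lexx orbT.
Qed.

(** * Comparison of integrals on an almost sure event *)

Section almost_sure_bounds.
Context d (T : measurableType d) (R : realType) (P : probability T R).
Variables (A : set T) (mA : measurable A) (PA : P A = 1%E).
Implicit Types f g : T -> R.

(** Replacing [g] by an infinite constant off the almost sure event does not change its integral.
    With a = -oo or +oo, an inequality known on [A] becomes one that holds everywhere, to which
    [le_integral_pointwise] applies. *)
Let ae_eq_restrict (g : T -> R) (a : \bar R) : bounded_measurable g ->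
  (\int[P]_x (if x \in A then (g x)%:E else a) = (\int[P]_x g x)%:E)%E.
Proof.
move=> bg; rewrite -bounded_measurable_EFin//.
have mg : measurable_fun setT (EFin \o g) by exact/measurable_EFinP/bg.1.
apply: ae_eq_integral => //.
  apply: measurable_fun_ifT => //; apply: (measurable_fun_bool true).
  by rewrite setTI preimage_mem_true.
exists (~` A); split; first exact: measurableC.
  by apply: etrans (probability_setC P mA) _; rewrite PA subee.
by move=> x /= h Ax; apply: h => _; rewrite mem_set.
Qed.

Lemma prob_integral_lower f g : bounded_measurable g ->
  (forall x, A x -> g x <= f x) ->
  ((\int[P]_x g x)%:E <= \int[P]_x (f x)%:E)%E.
Proof.
move=> bg gf; rewrite -(ae_eq_restrict -oo%E bg).
apply: le_integral_pointwise => x; case: ifPn => [|_]; last exact: leNye.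
by rewrite inE => Ax; rewrite lee_fin gf.
Qed.

Lemma prob_integral_upper f g : bounded_measurable g ->
  (forall x, A x -> f x <= g x) ->
  (\int[P]_x (f x)%:E <= (\int[P]_x g x)%:E)%E.
Proof.
move=> bg fg; rewrite -(ae_eq_restrict +oo%E bg).
apply: le_integral_pointwise => x; case: ifPn => [|_]; last exact: leey.
by rewrite inE => Ax; rewrite lee_fin fg.
Qed.

(** Both bounds serve the one conclusion: [fine] sends infinite values to 0, so the extended
    integral of [f] is first shown to be finite. *)
Lemma prob_Rintegral_lower f lo up :
  bounded_measurable lo -> bounded_measurable up ->
  (forall x, A x -> lo x <= f x <= up x) ->
  \int[P]_x lo x <= \int[P]_x f x.
Proof.
move=> blo bup lfu; rewrite -lee_fin.
have lof : ((\int[P]_x lo x)%:E <= \int[P]_x (f x)%:E)%E.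
  by apply: prob_integral_lower => // x /lfu/andP[].
have fup : (\int[P]_x (f x)%:E <= (\int[P]_x up x)%:E)%E.
  by apply: prob_integral_upper => // x /lfu/andP[].
rewrite [X in (_ <= X)%E]fineK// fin_numE gt_eqF ?lt_eqF//.
  exact: le_lt_trans fup (ltry _).
exact: lt_le_trans (ltNyr _) lof.
Qed.

Lemma le_prob_integral f g : bounded_measurable f -> bounded_measurable g ->
  (forall x, A x -> f x <= g x) -> \int[P]_x f x <= \int[P]_x g x.
Proof.
move=> bf bg fg; apply: prob_Rintegral_lower bf bg _ => x Ax.
by rewrite fg/=.
Qed.

Lemma eq_ae_prob_integral f g : bounded_measurable f -> bounded_measurable g ->
  (forall x, A x -> f x = g x) -> \int[P]_x f x = \int[P]_x g x.
Proof.
by move=> bf bg fg; apply/le_anti; rewrite !le_prob_integral// => x /fg ->.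
Qed.

End almost_sure_bounds.

Lemma product_probability_setT d1 d2 (T1 : measurableType d1)
    (T2 : measurableType d2) (R : realType)
    (P1 : probability T1 R) (P2 : probability T2 R) :
  (P1 \x P2)%E [set: T1 * T2] = 1%E.
Proof.
rewrite -setXTT [LHS]product_measure1E// -[RHS]mule1.
by congr (_ * _)%E; exact: probability_setT.
Qed.

(** * Iterated integrals on product spaces *)

Section bounded_measurable_fubini.
Context d1 d2 (T1 : measurableType d1) (T2 : measurableType d2) (R : realType).
Context (P1 : probability T1 R) (P2 : probability T2 R).
Variables (f : T1 -> T2 -> R).
Hypothesis bf : bounded_measurable (fun xy => f xy.1 xy.2).

Lemma bounded_measurable_section1 x : bounded_measurable (f x).
Proof.
by have := bounded_measurable_comp (pair1_measurable x) bf.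
Qed.

Lemma bounded_measurable_section2 y : bounded_measurable (f ^~ y).
Proof.
by have := bounded_measurable_comp (pair2_measurable y) bf.
Qed.

Lemma bounded_measurable_prod_integrable :
  (P1 \x P2)%E.-integrable setT (EFin \o (fun xy => f xy.1 xy.2)).
Proof.
case: bf => mf [M fM]; apply: measurable_bounded_integrable => //.
  by rewrite [ltLHS]product_probability_setT ltry.
exists M; split; first exact: num_real.
by move=> x Mx y _; apply: le_trans (fM y) (ltW Mx).
Qed.

Lemma bounded_measurable_integral : bounded_measurable (fun x => \int[P2]_y f x y).
Proof.
split.
  apply/measurable_EFinP; have := measurable_fubini_F bounded_measurable_prod_integrable.
  apply: eq_measurable_fun => x _ /=; rewrite /fubini_F/= -bounded_measurable_EFin//.
  exact: bounded_measurable_section1.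
case: bf => mf [M fM]; exists M => x; rewrite ler_norml.
have bx := bounded_measurable_section1 x.
have fMx y : - M <= f x y <= M by rewrite -ler_norml (fM (x, y)).
apply/andP; split.
  rewrite -[leLHS](prob_integral_cst P2).
  apply: (le_prob_integral measurableT (probability_setT P2)) => //.
    exact: bounded_measurable_cst.
  by move=> y _; case/andP: (fMx y).
rewrite -[leRHS](prob_integral_cst P2).
apply: (le_prob_integral measurableT (probability_setT P2)) => //.
  exact: bounded_measurable_cst.
by move=> y _; case/andP: (fMx y).
Qed.

Lemma prob_integral_prod :
  \int[(P1 \x P2)%E]_xy f xy.1 xy.2 = \int[P1]_x \int[P2]_y f x y.
Proof.
rewrite /Rintegral; congr fine; rewrite -(integral12_prod_meas1 bounded_measurable_prod_integrable).
apply: eq_integral => x _; rewrite /fubini_F/= -bounded_measurable_EFin//.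
exact: bounded_measurable_section1.
Qed.

End bounded_measurable_fubini.

Lemma prob_integral_swap d1 d2 (T1 : measurableType d1) (T2 : measurableType d2)
    (R : realType) (P1 : probability T1 R) (P2 : probability T2 R)
    (f : T1 -> T2 -> R) : bounded_measurable (fun xy => f xy.1 xy.2) ->
  \int[P1]_x \int[P2]_y f x y = \int[P2]_y \int[P1]_x f x y.
Proof.
move=> bf; have bf' : bounded_measurable (fun yx => f yx.2 yx.1).
  have := bounded_measurable_comp (@measurable_swap _ _ T2 T1) bf.
  exact.
apply: EFin_inj.
rewrite -(bounded_measurable_EFin P1 (bounded_measurable_integral P1 P2 bf)).
rewrite -(bounded_measurable_EFin P2 (bounded_measurable_integral P2 P1 bf')).
transitivity (\int[P1]_x \int[P2]_y (f x y)%:E)%E.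
  apply: eq_integral => x _; rewrite -bounded_measurable_EFin//.
  exact: bounded_measurable_section1 bf x.
rewrite (Fubini (bounded_measurable_prod_integrable P1 P2 bf)); apply: eq_integral => y _ /=.
rewrite -bounded_measurable_EFin//.
exact: bounded_measurable_section2 bf y.
Qed.

(** * The uniform distribution on the circle *)

Section fractional_part.
Variable R : realType.
Implicit Types x y : R.

(** The representative in [0, 1[ of a point of the circle R/Z. Thus [fpart (y - x)] is the distance
    from x to y in the increasing direction. *)
Definition fpart x : R := x - (Num.floor x)%:~R.

Lemma fpart_ge0 x : 0 <= fpart x.
Proof. by rewrite subr_ge0 floor_le. Qed.

Lemma fpart_lt1 x : fpart x < 1.
Proof. by have := floorD1_gt x; rewrite intrD /fpart; lra. Qed.

Lemma fpart_eqP x y : 0 <= y < 1 -> (exists k : int, x = y + k%:~R) -> fpart x = y.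
Proof.
move=> /andP[y0 y1] [k ->]; rewrite /fpart (@floor_def _ _ k) ?addrK//.
by rewrite intrD; apply/andP; split; lra.
Qed.

Lemma fpartE x : exists k : int, x = fpart x + k%:~R.
Proof. by exists (Num.floor x); rewrite subrK. Qed.

Lemma fpart_cong x y : (exists k : int, x = y + k%:~R) -> fpart x = fpart y.
Proof.
move=> [k ->]; apply: fpart_eqP; first by rewrite fpart_ge0 fpart_lt1.
by have [j {1}->] := fpartE y; exists (j + k); rewrite intrD addrA.
Qed.

Lemma fpart_id x : 0 <= x < 1 -> fpart x = x.
Proof. by move=> x01; apply: fpart_eqP => //; exists 0; rewrite addr0. Qed.

Lemma fpart_sub1 x : 1 <= x < 2 -> fpart x = x - 1.
Proof.
move=> x12; apply: fpart_eqP; first by lra.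
by exists 1; rewrite subrK.
Qed.

Lemma fpart_add1 x : -1 <= x < 0 -> fpart x = x + 1.
Proof.
move=> x12; apply: fpart_eqP; first by lra.
by exists (-1); rewrite addrK.
Qed.

Lemma fpartDl x y : fpart (fpart x + y) = fpart (x + y).
Proof.
apply: fpart_cong; have [k {2}->] := fpartE x.
by exists (- k); rewrite intrN; lra.
Qed.

Lemma fpartBr x y : fpart (x - fpart y) = fpart (x - y).
Proof.
apply: fpart_cong; have [k {2}->] := fpartE y.
by exists k; lra.
Qed.

Lemma measurable_fpart : measurable_fun setT fpart.
Proof.
apply: measurable_funB => //.
by apply: nondecreasing_measurable => // x y xy; rewrite ler_int le_floor.
Qed.

End fractional_part.

Section uniform_on_circle.
Variable R : realType.
Local Notation U := (unif01 R).

Lemma unif01E (A : set R) : measurable A ->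
  U A = lebesgue_measure (A `&` `[0, 1]).
Proof.
move=> mA; rewrite -[LHS]/(\int[lebesgue_measure]_(x in A) (uniform_pdf 0 1 x)%:E)%E.
rewrite integral_uniform_pdf.
rewrite (eq_integral (fun=> 1%E)); last first.
  by move=> x /[!inE] -[_ /=]; rewrite in_itv/= /uniform_pdf subr0 invr1 => ->.
by rewrite integral_cst ?mul1e//; exact: measurableI.
Qed.

Lemma unif01_itv (a b : R) (x y : bool) : 0 <= a -> a <= b -> b <= 1 ->
  U [set` Interval (BSide x a) (BSide y b)] = (b - a)%:E.
Proof.
move=> a0 ab b1; rewrite unif01E//.
have -> : [set` Interval (BSide x a) (BSide y b)] `&` `[0, 1] =
    [set` Interval (BSide x a) (BSide y b)].
  apply/setIidPl => z /=; rewrite !in_itv/= => /andP[az zb].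
  apply/andP; split.
    by apply: le_trans a0 _; move: az; case: x => //= /ltW.
  by apply: le_trans b1; move: zb; case: y => //= /ltW.
rewrite lebesgue_measure_itv/= lte_fin; case: ltP => // ba.
by rewrite (_ : b - a = 0)//; lra.
Qed.

Lemma unif01_ray (c : R) : 0 <= c <= 1 -> U `]-oo, c[%classic = c%:E.
Proof.
move=> /andP[c0 c1]; rewrite unif01E// -[c in RHS]subr0.
rewrite -(@unif01_itv 0 c true true)// unif01E//.
congr lebesgue_measure; apply/seteqP; split => x /=; rewrite !in_itv/=.
  by move=> [-> /andP[-> ->]].
by move=> [/andP[-> ->]].
Qed.

Definition measure_preserving_unif01 (f : R -> R) :=
  measurable_fun setT f /\ forall A, measurable A -> U (f @^-1` A) = U A.

(** The rays []-oo, c[] are stable under intersection and generate the Borel sets, so they determine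
    the image measure. Those with c outside [0, 1] follow by monotonicity from c = 0 and c = 1. *)
Lemma measure_preserving_unif01P (f : R -> R) : measurable_fun setT f ->
  (forall c, 0 <= c <= 1 -> U [set x | f x < c] = c%:E) ->
  measure_preserving_unif01 f.
Proof.
move=> mf fc; split=> // A mA.
have mpre (h : R -> R) c : measurable_fun setT h ->
    measurable (h @^-1` `]-oo, c[%classic).
  by move=> mh; rewrite -[X in measurable X]setTI; exact: mh.
have rayE c : 0 <= c <= 1 -> U (f @^-1` `]-oo, c[%classic) = c%:E.
  by move=> /fc <-; congr (U _); apply/seteqP; split => x /=; rewrite in_itv.
have U0 (h : R -> R) c : c <= 0 -> measurable_fun setT h ->
    U (h @^-1` `]-oo, 0[%classic) = 0 -> U (h @^-1` `]-oo, c[%classic) = 0.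
  move=> c0 mh h0; apply/eqP; rewrite eq_le measure_ge0 andbT -h0.
  apply: le_measure; rewrite ?inE; try exact: mpre.
  by move=> x /=; rewrite !in_itv/= => /lt_le_trans; exact.
have U1 (h : R -> R) c : 1 <= c -> measurable_fun setT h ->
    U (h @^-1` `]-oo, 1[%classic) = 1%E -> U (h @^-1` `]-oo, c[%classic) = 1%E.
  move=> c1 mh h1; apply/eqP; rewrite eq_le probability_le1; last exact: mpre.
  rewrite -h1; apply: le_measure; rewrite ?inE; try exact: mpre.
  by move=> x /=; rewrite !in_itv/= => /lt_le_trans; exact.
pose mf_mixin :=
  isMeasurableFun.Build _ _ (measurableTypeR R) (measurableTypeR R) _ mf.
pose g : {mfun measurableTypeR R >-> measurableTypeR R} := HB.pack f mf_mixin.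
apply: (@measure_unique _ R (measurableTypeR R) (@RGenInftyO.G R)
  (fun n => `]-oo, n%:R[%classic) _ _ _ _ (pushforward U g) U) => //.
- exact: RGenInftyO.measurableE.
- move=> _ _ [a ->] [b ->]; exists (Num.min a b); apply/seteqP; split=> x /=;
    by rewrite !in_itv/= lt_min => /andP.
- by move=> n; exists n%:R.
- apply/seteqP; split=> // x _; exists (Num.truncn `|x|).+1 => //=.
  by rewrite in_itv/= (le_lt_trans (ler_norm _))// truncnS_gt.
- move=> _ [c ->]; rewrite /= /pushforward.
  have [c0|c0] := leP c 0.
    rewrite U0 ?rayE ?lexx ?ler01//; apply/esym.
    by apply: (U0 id) => //; apply: etrans (unif01_ray _) _; rewrite ?lexx ?ler01.
  have [c1|c1] := leP 1 c.
    rewrite U1 ?rayE ?lexx ?ler01//; apply/esym.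
    by apply: (U1 id) => //; apply: etrans (unif01_ray _) _; rewrite ?lexx ?ler01.
  by rewrite rayE ?unif01_ray// (ltW c0) (ltW c1).
- by move=> n; apply: le_lt_trans (probability_le1 U (mpre _ _ mf)) (ltry _).
Qed.

End uniform_on_circle.

(** * Invariance of the uniform law under rotations and reflections *)

Section circle_isometries.
Variable R : realType.
Local Notation U := (unif01 R).
Implicit Types (f g : R -> R) (a : R).

(** The image measure of [unif01] under [f] is [unif01] itself, so this is the change of variables
    by [f]. *)
Lemma integral_measure_preserving_unif01 f (g : measurableTypeR R -> R) :
  measure_preserving_unif01 f -> bounded_measurable g ->
  \int[U]_z g (f z) = \int[U]_z g z.
Proof.
move=> [mf fU] bg; rewrite /Rintegral; congr fine.
have mg : measurable_fun setT (EFin \o g).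
  by apply/measurable_EFinP; case: bg.
pose mf_mixin :=
  isMeasurableFun.Build _ _ (measurableTypeR R) (measurableTypeR R) _ mf.
pose h : {mfun measurableTypeR R >-> measurableTypeR R} := HB.pack f mf_mixin.
transitivity (\int[pushforward U h]_z (g z)%:E)%E; last first.
  by apply: eq_measure_integral => A mA _; exact: (fU A mA).
rewrite integral_pushforward//=.
apply: (@bounded_measurable_integrable _ _ _ U (g \o h)).
exact: (bounded_measurable_comp (measurable_funPT h) bg).
Qed.

Lemma unif01_co01 : U `[0, 1[%classic = 1%E.
Proof. by rewrite unif01_itv// subr0. Qed.

(** The complement of [0, 1[ is negligible. On [0, 1[ the map [fpart] is the identity, which makes
    preimages computable. *)
Lemma unif01_setI_co01 (A : set R) : measurable A -> U A = U (A `&` `[0, 1[).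
Proof.
move=> mA; rewrite -[in LHS](setIT A) -(setvU `[0, 1[%classic) setIUr measureU//.
- rewrite [X in (X + _)%E](_ : _ = 0%E) ?add0e//.
  apply/eqP; rewrite eq_le measure_ge0 andbT.
  rewrite (@le_trans _ _ (U (~` `[0, 1[%classic)))//.
    by apply: le_measure; rewrite ?inE//; [apply: measurableI => //|]; exact: measurableC.
  by rewrite [leLHS]probability_setC// [X in (_ - X)%E]unif01_co01 subee.
- by apply: measurableI => //; exact: measurableC.
- exact: measurableI.
- by rewrite setIACA setICl setI0.
Qed.

Lemma measure_preserving_onem : measure_preserving_unif01 (fun z : R => 1 - z).
Proof.
apply: measure_preserving_unif01P => [|c /andP[c0 c1]].
  exact: measurable_funB.
transitivity (U `]1 - c, 1]%classic); last by rewrite unif01_itv//; [congr EFin|..]; lra.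
rewrite !unif01E//; first congr lebesgue_measure.
  apply/seteqP; split => x /=; rewrite !in_itv/= => -[A B]; split=> //; lra.
rewrite (_ : [set _ | _] = `]1 - c, +oo[%classic)//.
by apply/seteqP; split => x /=; rewrite in_itv/= ?andbT; lra.
Qed.

Lemma measurable_fpart_lt (c : R) (f : R -> R) :
  measurable_fun setT f -> measurable [set z | fpart (f z) < c].
Proof.
move=> mf; rewrite -[X in measurable X]setTI.
have -> : [set z | fpart (f z) < c] = (fpart (R:=R) \o f) @^-1` `]-oo, c[%classic.
  by apply/seteqP; split => z /=; rewrite in_itv.
by apply: measurableT_comp => //; exact: measurable_fpart.
Qed.

(** With b = fpart a, the points of [0, 1[ sent below c form [1 - b, 1 - b + c[ if c <= b, and
    otherwise [0, c - b[ together with [1 - b, 1[. The total length is c in both cases. *)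
Lemma measure_preserving_rotation a :
  measure_preserving_unif01 (fun z => fpart (a + z)).
Proof.
have ma : measurable_fun setT (fun z : R => a + z) by exact: measurable_funD.
apply: measure_preserving_unif01P => [|c /andP[c0 c1]].
  by apply: measurableT_comp => //; exact: measurable_fpart.
rewrite unif01_setI_co01; last exact: measurable_fpart_lt.
set b := fpart a.
have /andP[b0 b1] : 0 <= b < 1 by rewrite fpart_ge0 fpart_lt1.
have fE z : 0 <= z < 1 ->
    fpart (a + z) = if z < 1 - b then b + z else b + z - 1.
  move=> /andP[z0 z1]; rewrite -fpartDl -/b; case: (ltP z) => zb.
    by rewrite fpart_id//; lra.
  by rewrite fpart_sub1//; lra.
have [cb|bc] := leP c b.
  transitivity (U `[1 - b, 1 - b + c[%classic).
    congr (U _); apply/seteqP; split => z /=; rewrite !in_itv/=.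
      by move=> [+ z01]; rewrite fE//; case: (ltP z) => ? ?; lra.
    move=> z01; have z01' : 0 <= z < 1 by lra.
    by split=> //; rewrite fE//; case: (ltP z) => ?; lra.
  by rewrite unif01_itv; try congr EFin; lra.
transitivity (U (`[0, c - b[%classic `|` `[1 - b, 1[%classic)).
  congr (U _); apply/seteqP; split => z /=; rewrite !in_itv/=.
    move=> [+ z01]; rewrite fE//; case: (ltP z) => ? ?; [left|right]; lra.
  move=> z01; have z01' : 0 <= z < 1 by case: z01 => ?; lra.
  by split=> //; rewrite fE//; case: (ltP z) => ?; case: z01 => ?; lra.
rewrite measureU//.
  apply: etrans (congr2 +%E (unif01_itv true true _ _ _)
    (unif01_itv true true _ _ _)) _; rewrite -?EFinD; try congr EFin; lra.
by apply/seteqP; split => z //=; rewrite !in_itv/= => -[? ?]; lra.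
Qed.

Lemma measure_preserving_comp f g : measure_preserving_unif01 f ->
  measure_preserving_unif01 g -> measure_preserving_unif01 (f \o g).
Proof.
move=> [mf fU] [mg gU]; split; first exact: measurableT_comp.
move=> A mA; rewrite comp_preimage gU ?fU//.
by rewrite -[X in measurable X]setTI; exact: mf.
Qed.

Lemma measure_preserving_reflection a :
  measure_preserving_unif01 (fun z => fpart (a - z)).
Proof.
have := measure_preserving_comp (measure_preserving_rotation (a - 1))
  measure_preserving_onem.
by congr measure_preserving_unif01; apply/funext => z /=; congr fpart; lra.
Qed.

End circle_isometries.

(** * Minimum of a finite sequence of distances *)

Section minimum_of_sequence.
Variable R : realType.
Implicit Types (v : seq R) (a : R).

(** The starting value 1 is the length of the circle. The distances to which this is applied are at
    most 1, so that it matters only for an empty sequence. *)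
Definition minseq v : R := foldr Num.min 1 v.

Lemma le_minseq a v : (a <= minseq v) = (a <= 1) && all (>= a) v.
Proof. by elim: v => [|b v ih] /=; rewrite ?andbT// le_min ih andbCA. Qed.

Lemma minseq_le1 v : minseq v <= 1.
Proof. by have := lexx (minseq v); rewrite le_minseq => /andP[]. Qed.

Lemma minseq_le a v : a \in v -> minseq v <= a.
Proof.
by have := lexx (minseq v); rewrite le_minseq => /andP[_ /allP]; apply.
Qed.

Lemma minseq_eq a v : a \in v -> a <= 1 -> (forall b, b \in v -> a <= b) ->
  minseq v = a.
Proof.
move=> av a1 h; apply/le_anti; rewrite minseq_le// le_minseq a1/=.
exact/allP.
Qed.

Lemma minseq_in v : v != [::] -> (forall b, b \in v -> b <= 1) -> minseq v \in v.
Proof.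
elim: v => [//|b [|c v] ih] _ h /=.
  by rewrite min_l ?mem_head// h// mem_head.
rewrite in_cons; case: (leP b _) => _; first by rewrite eqxx.
by rewrite ih ?orbT// => e ev; rewrite h// in_cons ev orbT.
Qed.

Lemma eq_mem_minseq v w : v =i w -> minseq v = minseq w.
Proof.
move=> vw; have h a : (a <= minseq v) = (a <= minseq w).
  by rewrite !le_minseq (eq_all_r vw).
by apply/le_anti; rewrite -h lexx h lexx.
Qed.

Lemma le_sub_minseq v w : {subset v <= w} -> minseq w <= minseq v.
Proof.
by move=> vw; rewrite le_minseq minseq_le1; apply/allP => x /vw; exact: minseq_le.
Qed.

Lemma minseq_ge0 v : all (>= 0) v -> 0 <= minseq v.
Proof. by move=> v0; rewrite le_minseq ler01. Qed.

Lemma bounded_measurable_minseq d (T : measurableType d) (I : Type) (r : seq I)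
    (F : I -> T -> R) : (forall i, bounded_measurable (F i)) ->
  bounded_measurable (fun t => minseq [seq F i t | i <- r]).
Proof.
move=> bF; elim: r => [|i r ih]; first exact: bounded_measurable_cst.
exact: bounded_measurable_min.
Qed.

End minimum_of_sequence.

Lemma bounded_measurable_fpart d (T : measurableType d) (R : realType)
    (f : T -> R) : measurable_fun setT f ->
  bounded_measurable (fun t => fpart (f t)).
Proof.
move=> mf; split.
  by apply: measurableT_comp mf; exact: measurable_fpart.
by exists 1 => x; rewrite ger0_norm ?fpart_ge0// ltW// fpart_lt1.
Qed.

(** * Integrals of monomials over [0, a[ *)

Section monomial_integral.
Variable R : realType.
Local Notation U := (unif01 R).

Lemma bounded_measurable_indic_monomial (a : R) n : a <= 1 ->
  bounded_measurable (fun y : measurableTypeR R => \1_(`[0, a[%classic) y * y ^+ n).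
Proof.
move=> a1; split.
  apply: measurable_funM; last exact: measurable_funX.
  exact: measurable_indic.
exists 1 => x; rewrite indicE; case: (boolP (x \in _)); rewrite ?mul0r ?normr0//.
rewrite inE/= in_itv/= mul1r => /andP[x0 xa].
by rewrite normrX (ger0_norm x0) exprn_ile1// ltW// (lt_le_trans xa).
Qed.

Lemma Rintegral_lebesgue_monomial (a : R) n : 0 < a ->
  (\int[lebesgue_measure]_(x in `[0%R, a]) (x ^+ n)%:E = (a ^+ n.+1 / n.+1%:R)%:E)%E.
Proof.
move=> a0.
rewrite (@continuous_FTC2 _ _ (fun x => x ^+ n.+1 / n.+1%:R))//=.
- by rewrite expr0n/= mul0r sube0.
- by apply: continuous_subspaceT => x; exact: exprn_continuous.
- split.
  + move=> x _; apply: derivableM => //; exact: exprn_derivable.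
  + apply: cvg_at_right_filter; apply: cvgM; last exact: cvg_cst.
    exact: exprn_continuous.
  + apply: cvg_at_left_filter; apply: cvgM; last exact: cvg_cst.
    exact: exprn_continuous.
- move=> x _; rewrite derive1Mr; last exact: exprn_derivable.
  by rewrite derive1E exp_derive scaler1/= mulrAC mulfV// mul1r.
Qed.

Lemma unif01_integral_monomial (a : R) n : 0 <= a <= 1 ->
  \int[U]_y (\1_(`[0, a[%classic) y * y ^+ n) = a ^+ n.+1 / n.+1%:R.
Proof.
move=> /andP[a0 a1]; apply: EFin_inj.
rewrite -bounded_measurable_EFin; last exact: bounded_measurable_indic_monomial.
have [mf _] := @bounded_measurable_indic_monomial a n a1.
rewrite integral_uniform; last 2 first.
- exact/measurable_EFinP.
- move=> x; rewrite indicE lee_fin; case: (boolP (x \in _)); rewrite ?mul0r//.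
  by rewrite inE/= in_itv/= mul1r => /andP[x0 _]; rewrite exprn_ge0.
rewrite subr0 invr1 mul1e.
transitivity (\int[lebesgue_measure]_(x in `[0%R, a[) (x ^+ n)%:E)%E.
  rewrite [in RHS](_ : `[0, a[%classic = `[0, 1]%classic `&` `[0, a[); last first.
    apply/seteqP; split=> x /=; rewrite !in_itv/=; last by case.
    by move=> /andP[-> xa]; rewrite ltW// (lt_le_trans xa).
  rewrite integral_mkcondr; apply: eq_integral => x _.
  rewrite patchE; case: ifPn => [/set_mem xa|]; rewrite indicE.
    by rewrite mem_set// mul1r.
  by rewrite notin_setE => xa; rewrite memNset// mul0r.
(* The fundamental theorem of calculus is applied on a nondegenerate interval, so a = 0 is treated
   apart. *)
move: a0; rewrite le_eqVlt => /predU1P[<-|a0].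
  by rewrite set_itv_ge ?integral_set0 ?expr0n/= ?mul0r// bnd_simp ltxx.
rewrite -Rintegral_lebesgue_monomial//; apply: integral_itv_bndo_bndc.
by apply/measurable_EFinP; exact: measurable_funX.
Qed.

End monomial_integral.

(** * Distance to the next driver and sum of the squared gaps *)

Section distance_to_next_driver.
Variable R : realType.
Local Notation U := (unif01 R).
Implicit Types (s : seq R) (p z w a b : R).

(** The function m(s, z) of the overview. Along a gap of length l it decreases from l to 0 with
    slope -1, so this gap contributes l^(n+1) / (n+1) to the integral of its n-th power. *)
Definition next_dist s z : R := minseq [seq fpart (x - z) | x <- s].

Lemma bounded_measurable_next_dist s :
  bounded_measurable (next_dist s : measurableTypeR R -> R).
Proof.
apply: bounded_measurable_minseq => x; apply: bounded_measurable_fpart.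
exact: measurable_funB.
Qed.

Lemma next_dist_ge0 s z : 0 <= next_dist s z.
Proof. by apply: minseq_ge0; apply/allP => _ /mapP[x _ ->]; exact: fpart_ge0. Qed.

Lemma next_dist_le1 s z : next_dist s z <= 1.
Proof. exact: minseq_le1. Qed.

Lemma next_dist_cons p s z :
  next_dist (p :: s) z = Num.min (fpart (p - z)) (next_dist s z).
Proof. by []. Qed.

Lemma eq_mem_next_dist s t : s =i t -> next_dist s =1 next_dist t.
Proof. by move=> st z; apply: eq_mem_minseq; exact: eq_mem_map. Qed.

Lemma next_dist_shift s a z :
  next_dist [seq x - a | x <- s] z = next_dist s (a + z).
Proof.
rewrite /next_dist -map_comp; congr minseq; apply: eq_map => x /=.
by congr fpart; ring.
Qed.

Lemma next_dist_fpart s z : next_dist s (fpart z) = next_dist s z.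
Proof.
by rewrite /next_dist; congr minseq; apply: eq_map => x; rewrite fpartBr.
Qed.

(** The moments of m do not depend on the origin chosen on the circle, by rotation invariance of the
    uniform law. *)
Lemma integral_next_dist_shift n s a :
  \int[U]_z next_dist [seq x - a | x <- s] z ^+ n = \int[U]_z next_dist s z ^+ n.
Proof.
rewrite -[RHS](integral_measure_preserving_unif01
  (measure_preserving_rotation a)); last first.
  exact/bounded_measurableX/bounded_measurable_next_dist.
by apply: eq_prob_integral => z; rewrite next_dist_shift next_dist_fpart.
Qed.

(** The gaps on both sides of p when s holds the positions of the other drivers. Measuring backwards
    by 1 - fpart (x - p), and not by fpart (p - x), puts a driver located at p at distance 0 ahead
    and 1 behind, so that only [gap_after] vanishes because of it. *)
Definition gap_after s p : R := minseq [seq fpart (x - p) | x <- s].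
Definition gap_before s p : R := minseq [seq 1 - fpart (x - p) | x <- s].

Lemma gap_after_ge0 s p : 0 <= gap_after s p.
Proof. by apply: minseq_ge0; apply/allP => _ /mapP[x _ ->]; exact: fpart_ge0. Qed.

Lemma gap_before_ge0 s p : 0 <= gap_before s p.
Proof.
apply: minseq_ge0; apply/allP => _ /mapP[x _ ->].
by rewrite /= subr_ge0 ltW// fpart_lt1.
Qed.

(** Any single point x of s bounds the two gaps by 1 - fpart (x - p) and fpart (x - p), whose sum is
    1. *)
Lemma gap_beforeD_after s p : s != [::] -> gap_before s p + gap_after s p <= 1.
Proof.
case: s => // x s _; have xs : x \in x :: s by rewrite mem_head.
have := minseq_le (map_f (fun x => fpart (x - p)) xs).
have := minseq_le (map_f (fun x => 1 - fpart (x - p)) xs).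
by rewrite -/(gap_before _ p) -/(gap_after _ p) => ? ?; lra.
Qed.

(** No point of s is met from p - y up to p, p excluded. The distances from p - y to the points of s
    are therefore those from p increased by y, without wrapping around. *)
Lemma next_dist_before s p y : s != [::] -> 0 <= y < 1 ->
  y < gap_before s p -> next_dist s (fpart (p - y)) = gap_after s p + y.
Proof.
move=> s0 /andP[y0 y1] yA.
have sE x : x \in s -> fpart (x - (p - y)) = fpart (x - p) + y.
  move=> xs; rewrite (_ : _ - _ = (x - p) + y); last by ring.
  rewrite -fpartDl fpart_id// addr_ge0 ?fpart_ge0//=.
  have := minseq_le (map_f (fun x => 1 - fpart (x - p)) xs).
  by rewrite -/(gap_before _ p) => ?; lra.
rewrite next_dist_fpart; apply: minseq_eq.
- have /mapP[x xs ->] : gap_after s p \in [seq fpart (x - p) | x <- s].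
    apply: minseq_in; first by case: s s0 {yA sE}.
    by move=> _ /mapP[x _ ->]; rewrite ltW// fpart_lt1.
  by apply/mapP; exists x => //; rewrite sE.
- by have := gap_beforeD_after p s0; lra.
- move=> _ /mapP[x xs ->]; rewrite sE// lerD2r; apply: minseq_le.
  exact: (map_f (fun x => fpart (x - p))).
Qed.

(** The point of s that realizes [gap_before] lies ahead of p - y, at distance y - gap_before. *)
Lemma next_dist_after s p y : s != [::] -> 0 <= y < 1 ->
  gap_before s p <= y -> next_dist s (fpart (p - y)) <= y.
Proof.
move=> s0 /andP[y0 y1] Ay.
have /mapP[x xs xA] : gap_before s p \in [seq 1 - fpart (x - p) | x <- s].
  apply: minseq_in; first by case: s s0 {Ay}.
  by move=> _ /mapP[x _ ->]; have := fpart_ge0 (x - p); lra.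
rewrite next_dist_fpart.
apply: (@le_trans _ _ (fpart (x - (p - y)))).
  by apply: minseq_le; exact: (map_f (fun x => fpart (x - (p - y)))).
rewrite (_ : _ - _ = (x - p) + y); last by ring.
have := fpart_ge0 (x - p); have := fpart_lt1 (x - p) => ? ?.
by rewrite -fpartDl fpart_sub1; lra.
Qed.

(* Substituting z = p - y, the distances from z to the next point of s and of
   p :: s are y + gap_after and y when z lies in the gap before p, and they
   agree otherwise. *)
Lemma integral_next_distB n s p : s != [::] ->
  \int[U]_z (next_dist s z ^+ n - next_dist (p :: s) z ^+ n) =
  \int[U]_y (\1_(`[0, gap_before s p[%classic) y *
             ((gap_after s p + fpart y) ^+ n - fpart y ^+ n)).
Proof.
move=> s0; set A := gap_before s p; set B := gap_after s p.
have bn t : bounded_measurable (fun z : measurableTypeR R => next_dist t z ^+ n).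
  exact/bounded_measurableX/bounded_measurable_next_dist.
rewrite -[LHS](integral_measure_preserving_unif01
  (measure_preserving_reflection p)); last first.
  exact: bounded_measurableB.
have bf : bounded_measurable (fun y : measurableTypeR R => fpart y).
  exact: bounded_measurable_fpart.
apply: (@eq_ae_prob_integral _ _ _ U `[0, 1[%classic).
- exact: measurable_itv.
- exact: unif01_co01.
- apply: (bounded_measurable_comp (measure_preserving_reflection p).1
    (bounded_measurableB (bn s) (bn (p :: s)))).
- apply: bounded_measurableM.
    by apply: bounded_measurable_indic; exact: measurable_itv.
  apply: bounded_measurableB; apply: bounded_measurableX => //.
  by apply: bounded_measurableD => //; exact: bounded_measurable_cst.
move=> y /=; rewrite in_itv/= => y01; rewrite (fpart_id y01) next_dist_cons.
rewrite fpartBr (_ : p - (p - y) = y); last by ring.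
have /andP[y0 y1] := y01.
rewrite (fpart_id y01) indicE; case: (ltP y A) => yA.
  rewrite mem_set ?mul1r/= ?in_itv/= ?y0//.
  rewrite next_dist_before// min_l// lerDr; exact: gap_after_ge0.
rewrite memNset ?mul0r/= ?in_itv/= ?y0/= ?ltNge ?yA//.
by rewrite min_r ?subrr// next_dist_after.
Qed.

End distance_to_next_driver.

(** * Effect of removing a driver and of inserting a uniform one *)

Section removal_of_a_driver.
Variable R : realType.
Local Notation U := (unif01 R).
Implicit Types (s : seq R) (p z w a b m : R).

Let mono a k (y : measurableTypeR R) : R := \1_(`[0, a[%classic) y * y ^+ k.

(** Writing [fpart y] keeps the integrand bounded on the whole line; on the support [0, a[ of the
    indicator it is y. *)
Let monoE a (f : R -> R) (y : measurableTypeR R) : a <= 1 ->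
  \1_(`[0, a[%classic) y * f (fpart y) = \1_(`[0, a[%classic) y * f y.
Proof.
move=> a1; rewrite indicE; case: (boolP (y \in _)); rewrite ?mul0r// !mul1r.
by rewrite inE/= in_itv/= => /andP[y0 ya]; rewrite fpart_id// y0 (lt_le_trans ya).
Qed.

Let integral_quadratic a (c0 c1 c2 : R) : 0 <= a <= 1 ->
  \int[U]_y (\1_(`[0, a[%classic) y * (c0 + c1 * y + c2 * y ^+ 2)) =
  c0 * a + c1 * (a ^+ 2 / 2) + c2 * (a ^+ 3 / 3).
Proof.
move=> a01; have bm k c : bounded_measurable (fun y => c * mono a k y).
  apply/bounded_measurableZ/bounded_measurable_indic_monomial.
  by case/andP: a01.
transitivity (\int[U]_y (c0 * mono a 0 y + c1 * mono a 1 y + c2 * mono a 2 y)).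
  by apply: eq_prob_integral => y; rewrite /mono; ring.
rewrite !prob_integralD//; last exact: bounded_measurableD.
rewrite !prob_integralZ; try by apply: bounded_measurable_indic_monomial; case/andP: a01.
by rewrite !unif01_integral_monomial// expr1 divr1.
Qed.

(** Each difference is the integral of (b + y)^n - y^n over [0, a[. For n <= 3 this is a polynomial
    in y of degree at most 2, the form treated by [integral_quadratic]. *)
Lemma integral_removal s p : s != [::] ->
  let a := gap_before s p in let b := gap_after s p in
  [/\ \int[U]_z next_dist s z - \int[U]_z next_dist (p :: s) z = a * b,
      \int[U]_z next_dist s z ^+ 2 - \int[U]_z next_dist (p :: s) z ^+ 2 =
        a * b * (a + b) &
      \int[U]_z next_dist s z ^+ 3 - \int[U]_z next_dist (p :: s) z ^+ 3 =
        a ^+ 3 * b + 3 / 2 * a ^+ 2 * b ^+ 2 + a * b ^+ 3].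
Proof.
move=> s0 a b.
have a01 : 0 <= a <= 1.
  rewrite gap_before_ge0; have := gap_beforeD_after p s0.
  by have := gap_after_ge0 s p; rewrite -/a -/b; lra.
have bn n t : bounded_measurable (fun z : measurableTypeR R => next_dist t z ^+ n).
  exact/bounded_measurableX/bounded_measurable_next_dist.
have key n (c0 c1 c2 : R) :
    (forall y, (b + y) ^+ n - y ^+ n = c0 + c1 * y + c2 * y ^+ 2) ->
    \int[U]_z next_dist s z ^+ n - \int[U]_z next_dist (p :: s) z ^+ n =
    c0 * a + c1 * (a ^+ 2 / 2) + c2 * (a ^+ 3 / 3).
  move=> cE; rewrite -prob_integralB// integral_next_distB// -integral_quadratic//.
  apply: eq_prob_integral => y; rewrite -/a -/b.
  rewrite (monoE (fun x => (b + x) ^+ n - x ^+ n)) ?cE//.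
  by case/andP: a01.
split.
- rewrite -[LHS]/(\int[U]_z next_dist s z ^+ 1 -
    \int[U]_z next_dist (p :: s) z ^+ 1) (@key 1 b 0 0); last by move=> y; ring.
  by ring.
- rewrite (@key 2 (b ^+ 2) (2 * b) 0); last by move=> y; ring.
  by field.
- rewrite (@key 3 (b ^+ 3) (3 * b ^+ 2) (3 * b)); last by move=> y; ring.
  by field.
Qed.

(** A uniform w is at a uniform distance ahead of z, so this is the mean of min(Y, m) with Y
    uniform. It is the source of the term - int m^2 in the drift. *)
Lemma integral_min_fpart z m : 0 <= m <= 1 ->
  \int[U]_w Num.min (fpart (w - z)) m = m - m ^+ 2 / 2.
Proof.
move=> /andP[m0 m1].
have bmin : bounded_measurable (fun y : measurableTypeR R => Num.min (fpart y) m).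
  apply: bounded_measurable_min; last exact: bounded_measurable_cst.
  exact: bounded_measurable_fpart.
transitivity (\int[U]_y Num.min (fpart y) m).
  rewrite -[RHS](integral_measure_preserving_unif01
    (measure_preserving_rotation (- z)))//.
  apply: eq_prob_integral => w.
  by rewrite (fpart_id (x := fpart _)) ?fpart_ge0 ?fpart_lt1// addrC.
(* On [0, 1[, min(y, m) is m plus y - m restricted to y < m. *)
transitivity (\int[U]_y (m + (mono m 1 y - m * mono m 0 y))).
  apply: (@eq_ae_prob_integral _ _ _ U `[0, 1[%classic) => //.
  - exact: unif01_co01.
  - apply: bounded_measurableD; first exact: bounded_measurable_cst.
    apply: bounded_measurableB; last apply: bounded_measurableZ;
      exact: bounded_measurable_indic_monomial.
  move=> y /=; rewrite in_itv/= => y01; rewrite fpart_id// /mono indicE.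
  have /andP[y0 y1] := y01; case: (ltP y m) => ym.
    by rewrite mem_set/= ?in_itv/= ?y0//; ring.
  by rewrite memNset/= ?in_itv/= ?y0/= ?ltNge ?ym//; ring.
rewrite prob_integralD ?prob_integral_cst; first last.
- by apply: bounded_measurableB; last apply: bounded_measurableZ;
    exact: bounded_measurable_indic_monomial.
- exact: bounded_measurable_cst.
rewrite prob_integralB ?prob_integralZ; try apply: bounded_measurableZ;
  try exact: bounded_measurable_indic_monomial.
by rewrite !unif01_integral_monomial ?m0//; field.
Qed.

End removal_of_a_driver.

(** * The sum of the squared gaps as an integral *)

Section sum_of_squared_gaps.
Variable R : realType.
Local Notation U := (unif01 R).
Implicit Types (s r : seq R) (x y p f : R).

(* Sum of the squared gaps of the sorted positions p :: r when the last gap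
   ends at f instead of p. *)
Fixpoint sq_gaps f p r : R :=
  if r is q :: r' then (q - p) ^+ 2 + sq_gaps f q r' else (1 - p + f) ^+ 2.

Lemma sq_gapsE f p r :
  \sum_(0 <= k < (size r).+1) (if (k.+1 < (size r).+1)%N
    then (p :: r)`_k.+1 - (p :: r)`_k else 1 - (p :: r)`_k + f) ^+ 2 =
  sq_gaps f p r.
Proof.
elim: r p => [|q r ih] p; first by rewrite big_nat1.
by rewrite big_nat_recl//= -ih.
Qed.

(** Only the last gap, which closes the circle, depends on the end point. *)
Lemma sq_gaps_first f g p r :
  sq_gaps f p r = sq_gaps g p r - (1 - last p r + g) ^+ 2
                  + (1 - last p r + f) ^+ 2.
Proof.
elim: r p => [|q r ih] p /=; first by ring.
by rewrite ih; ring.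
Qed.

Lemma path_le_last y r : path <=%R y r -> {in y :: r, forall q, q <= last y r}.
Proof.
elim: r y => [|z r ih] y /=; first by move=> _ q; rewrite inE => /eqP ->.
move=> /andP[yz /ih h] q; rewrite inE => /predU1P[->|/h//].
by rewrite (le_trans yz)// h// mem_head.
Qed.

(** As x comes first, the driver after it is y and the one before it, across the origin, is the last
    one. *)
Lemma gap_product_first x y r : path <=%R x (y :: r) -> 0 <= x -> last y r <= 1 ->
  gap_before (y :: r) x * gap_after (y :: r) x = (y - x) * (1 - last y r + x).
Proof.
move=> /= /andP[xy yr] x0 L1.
have qL := path_le_last yr.
have yq : {in y :: r, forall q, y <= q}.
  move=> q; rewrite inE => /predU1P[->//|qr].
  by have /allP := order_path_min (@le_trans _ _) yr; apply.
have Lr : last y r \in y :: r by exact: mem_last.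
have [Lx|Lx] := ltP (last y r - x) 1.
  have fE q : q \in y :: r -> fpart (q - x) = q - x.
    move=> qr; rewrite fpart_id//; have := qL q qr; have := yq q qr.
    by move=> ? ?; lra.
  have -> : gap_after (y :: r) x = y - x.
    apply: minseq_eq.
    - by apply/mapP; exists y; rewrite ?mem_head// fE ?mem_head.
    - by have := yq _ Lr; lra.
    - by move=> _ /mapP[q qr ->]; rewrite fE// lerD2r yq.
  have -> : gap_before (y :: r) x = 1 - (last y r - x).
    apply: minseq_eq.
    - by apply/mapP; exists (last y r); rewrite // fE.
    - by have := yq _ Lr; lra.
    - by move=> _ /mapP[q qr ->]; rewrite fE// lerD2l lerN2 lerD2r qL.
  by ring.
(* Here x = 0 and the last driver is at 1, the same point of the circle; both products vanish. *)
have Lx1 : last y r - x = 1 by lra.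
have -> : gap_after (y :: r) x = 0.
  apply/le_anti; rewrite gap_after_ge0 andbT.
  have : fpart (last y r - x) = 0 by rewrite Lx1 fpart_sub1 ?subrr//; lra.
  move=> <-; apply: minseq_le.
  exact: (map_f (fun q => fpart (q - x))).
by rewrite (_ : 1 - last y r + x = 0) ?mulr0//; lra.
Qed.

(** Induction on the number of drivers. Removing the first one merges its two gaps a and b, which
    adds 2ab to the sum of squares; by [integral_removal], twice the integral grows by the same
    amount. *)
Lemma sq_gaps_integral x r : path <=%R x r -> 0 <= x -> last x r <= 1 ->
  sq_gaps x x r = 2 * \int[U]_z next_dist (x :: r) z.
Proof.
elim: r x => [|y r ih] x.
  move=> _ _ _ /=.
  rewrite -(integral_measure_preserving_unif01
    (measure_preserving_reflection x)); last first.
    exact: bounded_measurable_next_dist.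
  (* A single driver leaves one gap of length 1, and the mean distance to it is m - m^2 / 2 at m =
     1. *)
  rewrite (_ : \int[U]_z _ = 1 - 1 ^+ 2 / 2); last first.
    rewrite -(@integral_min_fpart _ 0 1) ?ler01 ?lexx//.
    apply: eq_prob_integral => z; rewrite /next_dist/= fpartBr subr0.
    by congr (Num.min (fpart _) _); ring.
  by field.
move=> xyr x0 L1; have /= /andP[xy yr] := xyr.
have yr_ne : y :: r != [::] by [].
have [rem _ _] := integral_removal x yr_ne.
rewrite gap_product_first// in rem.
(* Moving the end point from x to y closes the circle on [y :: r], as in the induction
   hypothesis. *)
rewrite /= (@sq_gaps_first x y) ih ?(le_trans x0 xy)//.
rewrite (_ : \int[U]_z next_dist [:: x, y & r] z =
  \int[U]_z next_dist (y :: r) z - (y - x) * (1 - last y r + x)).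
  by ring.
by rewrite -rem; ring.
Qed.

(** Each gap l contributes l^2 / 2 to the integral. Sorting is harmless because [next_dist] depends
    only on the set of positions. *)
Lemma V_gaps_integral (N : nat) (s : N.-tuple R) : (0 < N)%N ->
  (forall i, 0 <= tnth s i <= 1) ->
  V (gaps s) = 2 * \int[U]_z next_dist s z.
Proof.
move=> N0 s01.
have s01' x : x \in sort <=%R s -> 0 <= x <= 1.
  by rewrite mem_sort => /tnthP[i ->].
have := sort_sorted (@le_total _ R) s.
have : size (sort <=%R s) = N by rewrite size_sort size_tuple.
rewrite -(eq_prob_integral U (eq_mem_next_dist (mem_sort <=%R s))).
rewrite /V /gaps; under eq_bigr do rewrite tnth_mktuple.
case: (sort <=%R s) s01' => [_ N0'|x r s01' Nr xr]; first by rewrite -N0' in N0.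
rewrite -sq_gaps_integral//.
- rewrite -sq_gapsE -Nr big_mkord; exact: eq_bigr.
- by have /andP[] := s01' _ (mem_head x r).
- by have /andP[] := s01' _ (mem_last x r).
Qed.

End sum_of_squared_gaps.

(** * Lower bound on the drift *)

Section closest_driver.
Variables (R : realType) (N : nat).
Implicit Types (c s : N.-tuple R) (u v w : R) (k : 'I_N).

(** Removal is by index and not by position: another driver at the same point stays in the
    sequence. *)
Definition others c k : seq R := [seq tnth c j | j <- enum 'I_N & j != k].

Lemma othersP c k x : reflect (exists2 j, j != k & x = tnth c j) (x \in others c k).
Proof.
apply: (iffP mapP) => [[j]|[j jk ->]].
  by rewrite mem_filter => /andP[jk _] ->; exists j.
by exists j => //; rewrite mem_filter jk mem_enum.
Qed.

Lemma mem_others c k : c =i tnth c k :: others c k.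
Proof.
move=> x; rewrite in_cons; apply/idP/idP => [/tnthP[j ->]|].
  have [->|jk] := eqVneq j k; first by rewrite eqxx.
  by apply/orP; right; apply/othersP; exists j.
by case/predU1P => [->|/othersP[j _ ->]]; exact: mem_tnth.
Qed.

Lemma others_neq0 c k : (1 < N)%N -> others c k != [::].
Proof.
move=> N1; have [j jk] : exists j : 'I_N, j != k.
  case: (eqVneq k (Ordinal N1)) => [->|]; last by exists (Ordinal N1); rewrite eq_sym.
  by exists (Ordinal (ltnW N1)).
have : tnth c j \in others c k by apply/othersP; exists j.
by case: (others c k).
Qed.

(** Equality as sets suffices, since [V] is computed from [next_dist], which ignores order and
    repetitions. *)
Lemma mem_step c u w k : closest c u = Some k -> step c u w =i w :: others c k.
Proof.
move=> ck x; rewrite in_cons; apply/idP/idP.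
  move=> /tnthP[j ->]; rewrite tnth_mktuple ck; case: (Some k =P Some j) => [_|kj].
    by rewrite eqxx.
  apply/orP; right; apply/othersP; exists j => //.
  by apply: contra_not_neq kj => ->.
case/predU1P => [->|/othersP[j jk ->]]; apply/tnthP.
  by exists k; rewrite tnth_mktuple ck eqxx.
exists j; rewrite tnth_mktuple ck; case: (Some k =P Some j) => // -[kj].
by rewrite kj eqxx in jk.
Qed.

Lemma circle_distE u v : 0 <= u <= 1 -> 0 <= v <= 1 ->
  circle_dist u v = Num.min (fpart (v - u)) (1 - fpart (v - u)).
Proof.
move=> u01 v01; rewrite /circle_dist; have [vu|uv] := ltP v u.
  rewrite fpart_add1; last by lra.
  by rewrite ltr0_norm 1?minC; [congr Num.min|]; lra.
rewrite ger0_norm; last by lra.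
have [vu1|vu1] := ltP (v - u) 1; first by rewrite fpart_id//; lra.
(* The remaining case is u = 0 and v = 1, a single point of the circle. *)
rewrite fpart_sub1; last by lra.
by rewrite (_ : v - u = 1) ?subrr ?subr0 1?minC//; lra.
Qed.

Lemma circle_distC u v : circle_dist u v = circle_dist v u.
Proof. by rewrite /circle_dist distrC. Qed.

Lemma closest_exists c u : (0 < N)%N ->
  exists2 k, closest c u = Some k &
    forall j, circle_dist u (tnth c k) <= circle_dist u (tnth c j).
Proof.
move=> N0; rewrite /closest; case: pickP => [k /forallP kP|none].
  by exists k.
case: (@arg_minP _ _ _ (Ordinal N0) xpredT
  (fun k => circle_dist u (tnth c k))) => // k _ kP.
by have /negP[] := negbT (none k); apply/forallP => j; exact: kP.
Qed.

(* Points of the Voronoi cell of driver k, described by the position of the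
   user relatively to the driver; a driver sharing its position with another one
   gets an empty cell. *)
Definition cell c k : set R := [set u |
  let y := fpart (u - tnth c k) in
  0 < gap_after (others c k) (tnth c k) /\
  (y < gap_after (others c k) (tnth c k) / 2 \/
   1 - gap_before (others c k) (tnth c k) / 2 < y)].

(** Let y and d be the forward distances from driver k to the user and to driver j, so that B <= d
    <= 1 - A. A user within half of a neighbouring gap is closer to driver k. For a user behind
    driver k, strictness also rests on d > 0, which comes from the condition 0 < B in [cell]. *)
Lemma cell_lt_circle_dist c k j u : (forall i, 0 <= tnth c i <= 1) ->
  0 <= u <= 1 -> cell c k u -> j != k ->
  circle_dist u (tnth c k) < circle_dist u (tnth c j).
Proof.
move=> c01 u01 [/= B0 yP] jk; have jo : tnth c j \in others c k.
  by apply/othersP; exists j.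
have := minseq_le (map_f (fun x => fpart (x - tnth c k)) jo).
have := minseq_le (map_f (fun x => 1 - fpart (x - tnth c k)) jo).
rewrite -/(gap_before _ (tnth c k)) -/(gap_after _ (tnth c k)).
rewrite circle_distC !circle_distE//.
have -> : fpart (tnth c j - u) =
    fpart (fpart (tnth c j - tnth c k) - fpart (u - tnth c k)).
  by rewrite fpartDl fpartBr; congr fpart; ring.
move: yP B0; set A := gap_before _ _; set B := gap_after _ _.
set y := fpart (u - _); set d := fpart (tnth c j - _) => yP B0 dA dB.
have d1 : d < 1 by exact: fpart_lt1.
have y0 : 0 <= y by exact: fpart_ge0.
have y1 : y < 1 by exact: fpart_lt1.
have A0 : 0 <= A by exact: gap_before_ge0.
case: yP => yP.
  rewrite fpart_id; last by lra.
  by rewrite lt_min !gt_min; apply/andP; split; apply/orP; left; lra.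
rewrite fpart_add1; last by lra.
by rewrite lt_min !gt_min; apply/andP; split; apply/orP; right; lra.
Qed.

(** The strict inequality excludes ties on a cell, so the closest driver is determined there. *)
Lemma cell_closest c k l u : (forall i, 0 <= tnth c i <= 1) ->
  0 <= u <= 1 -> cell c k u ->
  (forall j, circle_dist u (tnth c l) <= circle_dist u (tnth c j)) -> l = k.
Proof.
move=> c01 u01 uk lP; apply/eqP/negPn/negP => lk.
by have := lP k; rewrite leNgt cell_lt_circle_dist.
Qed.

Lemma measurable_cell c k : measurable (cell c k).
Proof.
set p := tnth c k; set A := gap_before (others c k) p.
set B := gap_after (others c k) p.
have [B0|B0] := ltP 0 B; last first.
  rewrite (_ : cell c k = set0)//; apply/seteqP; split => // u [/=].
  by rewrite -/p -/B ltNge B0.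
have mf : measurable_fun setT (fun u : R => fpart (u - p)).
  by apply: measurableT_comp; [exact: measurable_fpart|exact: measurable_funB].
have -> : cell c k = (fun u => fpart (u - p)) @^-1`
    ([set` `]-oo, B / 2[] `|` [set` `]1 - A / 2, +oo[]).
  apply/seteqP; split => u /=; rewrite !in_itv/= ?andbT.
    by move=> [].
  by move=> ?; split.
rewrite -[X in measurable X]setTI; apply: mf => //.
by apply: measurableU; exact: measurable_itv.
Qed.

(** The rotation by -p brings the driver to the origin. In [0, 1[ the cell becomes [0, B /
    2[ together with ]1 - A / 2, 1[, which are disjoint as A + B <= 1. *)
Lemma unif01_cell c k : (1 < N)%N ->
  0 < gap_after (others c k) (tnth c k) ->
  unif01 R (cell c k) = ((gap_before (others c k) (tnth c k) +
                          gap_after (others c k) (tnth c k)) / 2)%:E.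
Proof.
move=> N1; set p := tnth c k; set A := gap_before (others c k) p.
set B := gap_after (others c k) p => B0.
have AB1 : A + B <= 1 by apply: gap_beforeD_after; exact: others_neq0.
have A0 : 0 <= A by exact: gap_before_ge0.
set W : set R := [set` `]-oo, B / 2[] `|` [set` `]1 - A / 2, +oo[].
have mW : measurable W by apply: measurableU; exact: measurable_itv.
have -> : cell c k = (fun u => fpart (- p + u)) @^-1` W.
  apply/seteqP; split => u; rewrite /W/= !in_itv/= ?andbT [- p + u]addrC.
    by move=> [].
  by move=> ?; split.
rewrite (measure_preserving_rotation (- p)).2// unif01_setI_co01//.
have -> : W `&` `[0, 1[ = `[0, B / 2[ `|` `]1 - A / 2, 1[ :> set R.
  apply/seteqP; split => u; rewrite /W/= !in_itv/= ?andbT.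
    by move=> [[?|?] ?]; [left|right]; lra.
  by move=> [?|?]; split; lra.
rewrite measureU//.
- apply: etrans (congr2 +%E (unif01_itv true true _ _ _)
    (unif01_itv false true _ _ _)) _; rewrite -?EFinD; try congr EFin; lra.
- by apply/seteqP; split => z //=; rewrite !in_itv/= => -[? ?]; lra.
Qed.

End closest_driver.

(** * The product of two probabilities as a probability *)

Section product_probability.
Context d1 d2 (T1 : measurableType d1) (T2 : measurableType d2) (R : realType).
Context (P1 : probability T1 R) (P2 : probability T2 R).

Let prod := (P1 \x P2)%E.

HB.instance Definition _ := Measure.on prod.

HB.instance Definition _ := Measure_isProbability.Build _ _ _ prod
  (product_probability_setT P1 P2).

Definition product_probability : probability (T1 * T2)%type R := prod.

End product_probability.

(** * Integration over the user and the new driver *)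

Section drift_lower_bound.
Variables (R : realType) (N : nat).
Hypothesis N1 : (1 < N)%N.
Local Notation U := (unif01 R).
Implicit Types (c s : N.-tuple R) (u v w : R) (k : 'I_N).

(** The function is [next_dist (w :: r) z], seen as depending on the pair (w, z). *)
Lemma bounded_measurable_min_next_dist (r : seq R) :
  bounded_measurable (fun wz : measurableTypeR R * measurableTypeR R =>
    Num.min (fpart (wz.1 - wz.2)) (next_dist r wz.2)).
Proof.
apply: bounded_measurable_min.
  by apply: bounded_measurable_fpart; exact: measurable_funB.
apply: (bounded_measurable_comp _ (bounded_measurable_next_dist r)).
exact: measurable_snd.
Qed.

(* I r w is the value of V after inserting w among the positions r. *)
Let I (r : seq R) (w : measurableTypeR R) : R := 2 * \int[U]_z next_dist (w :: r) z.

Let bounded_measurable_I r : bounded_measurable (I r).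
Proof.
apply: bounded_measurableZ.
exact: (bounded_measurable_integral U U (bounded_measurable_min_next_dist r)).
Qed.

(** Once the integrals over w and z are exchanged, [integral_min_fpart] gives the mean over w at
    each fixed z. *)
Let integral_I r :
  \int[U]_w I r w = 2 * \int[U]_z next_dist r z - \int[U]_z next_dist r z ^+ 2.
Proof.
have bm := bounded_measurable_next_dist r.
rewrite prob_integralZ; last first.
  exact: (bounded_measurable_integral U U (bounded_measurable_min_next_dist r)).
rewrite (prob_integral_swap U U (bounded_measurable_min_next_dist r)).
transitivity (2 * \int[U]_z (next_dist r z - 2^-1 * next_dist r z ^+ 2)).
  congr (_ * _); apply: eq_prob_integral => z.
  by rewrite integral_min_fpart ?next_dist_ge0 ?next_dist_le1// mulrC.
rewrite prob_integralB// ?prob_integralZ//; last first.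
- exact/bounded_measurableZ/bounded_measurableX.
- exact/bounded_measurableX.
by field.
Qed.

Let le_I r r' w : {subset r <= r'} -> I r' w <= I r w.
Proof.
move=> rr'; rewrite ler_pM2l//.
apply: (le_prob_integral measurableT (@probability_setT _ _ _ U)).
- exact: bounded_measurable_next_dist.
- exact: bounded_measurable_next_dist.
move=> z _; apply: le_sub_minseq => x; rewrite /= !in_cons => /orP[->//|xr].
apply/orP; right; case/mapP: xr => y yr ->.
by apply/mapP; exists y => //; exact: rr'.
Qed.

Let V_step c u w k : (forall i, 0 <= tnth c i <= 1) -> 0 <= w <= 1 ->
  closest c u = Some k -> V (gaps (step c u w)) = I (others c k) w.
Proof.
move=> c01 w01 ck; rewrite V_gaps_integral ?(ltnW N1)//; last first.
  by move=> i; rewrite tnth_mktuple; case: ifP.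
by congr (_ * _); apply: eq_prob_integral; exact/eq_mem_next_dist/mem_step.
Qed.

(** A measurable minorant of [V (gaps (step c u w))]. It is exact when u lies in a cell; elsewhere
    it is [I c w], the value with w inserted and no driver removed, which is smaller by [le_I]. *)
Let lower c u w := I c w +
  \sum_(k < N) \1_(cell c k) u * (I (others c k) w - I c w).

Let lower_le c u w : (forall i, 0 <= tnth c i <= 1) -> 0 <= u <= 1 ->
  0 <= w <= 1 -> lower c u w <= V (gaps (step c u w)).
Proof.
move=> c01 u01 w01.
have [k ck kP] := closest_exists c u (ltnW N1).
have Ik : I c w <= I (others c k) w.
  by apply: le_I => x /othersP[j _ ->]; exact: mem_tnth.
rewrite (@V_step c u w k)// /lower (bigD1 k)//= big1 ?addr0.
  rewrite -lerBrDl indicE; case: (_ \in _); rewrite ?mul1r ?lexx// mul0r subr_ge0//.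
move=> j jk; rewrite indicE memNset ?mul0r// => uj.
by move: jk; rewrite (@cell_closest _ _ c j k u) ?eqxx.
Qed.

(** Together with [lower_le], this encloses the integrand between bounded functions, so that its
    integral is finite. *)
Let step_le2 c u w : (forall i, 0 <= tnth c i <= 1) -> 0 <= w <= 1 ->
  V (gaps (step c u w)) <= 2.
Proof.
move=> c01 w01; have [k ck _] := closest_exists c u (ltnW N1).
rewrite (@V_step c u w k)// ger_pMr//.
rewrite -[leRHS](prob_integral_cst U).
apply: (le_prob_integral measurableT (@probability_setT _ _ _ U)).
- exact: bounded_measurable_next_dist.
- exact: bounded_measurable_cst.
by move=> z _; exact: next_dist_le1.
Qed.

Let square01 : (U \x U)%E (`[0, 1]%classic `*` `[0, 1]%classic) = 1%E.
Proof.
rewrite [LHS]product_measure1E// -[RHS]mule1.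
by congr (_ * _)%E; apply: etrans (unif01_itv true false _ _ _) _; rewrite ?subr0.
Qed.

Let bounded_measurable_lower c :
  bounded_measurable (fun uw : measurableTypeR R * measurableTypeR R =>
    lower c uw.1 uw.2).
Proof.
have b2 r : bounded_measurable (fun uw : measurableTypeR R * measurableTypeR R =>
    I r uw.2).
  by apply: (bounded_measurable_comp _ (bounded_measurable_I r)); exact: measurable_snd.
apply: bounded_measurableD => //; apply: bounded_measurable_sum => k.
apply: bounded_measurableM; last exact: bounded_measurableB.
have bi : bounded_measurable (\1_(cell c k) : measurableTypeR R -> R).
  by apply: bounded_measurable_indic; exact: measurable_cell.
by apply: (bounded_measurable_comp _ bi); exact: measurable_fst.
Qed.

Let integral_lower c : \int[(U \x U)%E]_uw lower c uw.1 uw.2 =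
  \int[U]_w I c w + \sum_(k < N) fine (U (cell c k)) *
    (\int[U]_w I (others c k) w - \int[U]_w I c w).
Proof.
have bi k : bounded_measurable (\1_(cell c k) : measurableTypeR R -> R).
  by apply: bounded_measurable_indic; exact: measurable_cell.
rewrite (prob_integral_prod U U (bounded_measurable_lower c)).
transitivity (\int[U]_u (\int[U]_w I c w + \sum_(k < N)
    (\int[U]_w I (others c k) w - \int[U]_w I c w) * \1_(cell c k) u)).
  apply: eq_prob_integral => u; rewrite /lower.
  have bIk k : bounded_measurable (fun w : measurableTypeR R =>
      \1_(cell c k) u * (I (others c k) w - I c w)).
    exact/bounded_measurableZ/bounded_measurableB.
  rewrite prob_integralD//; last exact: bounded_measurable_sum.
  rewrite prob_integral_sum//; congr (_ + _); apply: eq_bigr => k _.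
  rewrite prob_integralZ; last exact: bounded_measurableB.
  by rewrite prob_integralB// mulrC.
have bZ k : bounded_measurable (fun u : measurableTypeR R =>
   (\int[U]_w I (others c k) w - \int[U]_w I c w) * \1_(cell c k) u).
  exact: bounded_measurableZ.
rewrite prob_integralD ?prob_integral_cst; last 2 first.
- exact: bounded_measurable_cst.
- exact: bounded_measurable_sum.
congr (_ + _); rewrite prob_integral_sum//; apply: eq_bigr => k _.
rewrite prob_integralZ// prob_integral_indic 1?mulrC//.
exact: measurable_cell.
Qed.

(** For B > 0 the right side minus the left one is AB (A - B)^2 / 14. With a constant t in place of
    4/7 it would be (t - 1/2) (A^3 B + A B^3) + (3t/2 - 1) A^2 B^2, and t = 4/7 is the least value
    that keeps this nonnegative when A = B. *)
Let cell_term c k : (forall i, 0 <= tnth c i <= 1) ->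
  \int[U]_z next_dist (others c k) z ^+ 2 - \int[U]_z next_dist c z ^+ 2 -
  4 / 7 * (\int[U]_z next_dist (others c k) z ^+ 3 - \int[U]_z next_dist c z ^+ 3)
  <= fine (U (cell c k)) * (\int[U]_w I (others c k) w - \int[U]_w I c w).
Proof.
move=> c01; rewrite !integral_I.
have nE n : \int[U]_z next_dist c z ^+ n =
    \int[U]_z next_dist (tnth c k :: others c k) z ^+ n.
  by apply: eq_prob_integral => z; rewrite (eq_mem_next_dist (mem_others c k)).
have := nE 1; rewrite -[LHS]/(\int[U]_z next_dist c z).
rewrite -[RHS]/(\int[U]_z next_dist (tnth c k :: others c k) z) => ->.
rewrite !nE.
have [] := integral_removal (tnth c k) (others_neq0 c k N1).
set A := gap_before _ _; set B := gap_after _ _ => r1 r2 r3.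
have A0 : 0 <= A by exact: gap_before_ge0.
have B0 : 0 <= B by exact: gap_after_ge0.
have AB1 : A + B <= 1 by apply: gap_beforeD_after; exact: others_neq0.
rewrite r2 r3.
rewrite (_ : (_ - _) - (_ - _) = 2 * (A * B) - A * B * (A + B)); last first.
  have aux (x y z t : R) : 2 * x - y - (2 * z - t) = 2 * (x - z) - (y - t) by ring.
  by rewrite -[A * B * (A + B)]r2 -[A * B]r1; exact: aux.
(* When B = 0 the cell is empty, and both sides vanish with the factor B. *)
have [Bpos|] := ltP 0 B; last first.
  move=> Bneg; have -> : B = 0 by apply/le_anti; rewrite Bneg.
  by rewrite !(mulr0, mul0r, expr0n, addr0, subr0).
rewrite unif01_cell//= -/A -/B -subr_ge0.
have AB : 0 <= A * B * (A - B) ^+ 2 by rewrite mulr_ge0 ?sqr_ge0// mulr_ge0.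
rewrite (_ : _ - _ = A * B * (A - B) ^+ 2 / 14); last by field.
by rewrite divr_ge0.
Qed.

(** The minorant [lower] is integrated. By [integral_I] the mean of [I c] is C - int m^2, so that C
    cancels; [cell_term] then bounds each term of the sum over the cells. *)
Lemma drift_ge c : (forall i, 0 <= tnth c i <= 1) ->
  \sum_(k < N)
    (\int[U]_z next_dist (others c k) z ^+ 2 - \int[U]_z next_dist c z ^+ 2 -
     4 / 7 * (\int[U]_z next_dist (others c k) z ^+ 3 -
              \int[U]_z next_dist c z ^+ 3)) - \int[U]_z next_dist c z ^+ 2
  <= \int[(U \x U)%E]_uw
       (V (gaps (step c uw.1 uw.2)) - 2 * \int[U]_z next_dist c z).
Proof.
move=> c01; set C := 2 * _.
have bC d (T : measurableType d) : bounded_measurable (fun _ : T => C).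
  exact: bounded_measurable_cst.
apply: (@le_trans _ _ (\int[(U \x U)%E]_uw (lower c uw.1 uw.2 - C))).
  have blo := bounded_measurable_lower c.
  rewrite (@prob_integralB _ _ _ (product_probability U U))//.
  rewrite [X in _ <= X - _]integral_lower (prob_integral_cst (product_probability U U)).
  have aux (x y z : R) : x - y + z - x = z - y by ring.
  rewrite integral_I -/C aux.
  rewrite lerD2r; apply: ler_sum => k _.
  by rewrite /C -integral_I; exact: cell_term.
apply: (@prob_Rintegral_lower _ _ _ (product_probability U U)
  (`[0, 1]%classic `*` `[0, 1]%classic) _ square01 _ _ (fun=> 2 - C)).
- by apply: measurableX; exact: measurable_itv.
- exact: bounded_measurableB.
- exact: bounded_measurable_cst.
move=> [u w] [/=]; rewrite !in_itv/= => u01 w01.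
by rewrite !lerD2r lower_le ?step_le2.
Qed.

End drift_lower_bound.

(** * From the configuration rebuilt from the gaps to the positions *)

Section drift_of_gap_vector.
Variables (R : realType) (N : nat).
Local Notation U := (unif01 R).
Implicit Types (s : N.-tuple R) (k : 'I_N).

(** The sum of the gaps telescopes. Since k < N, the last gap, through the origin, is never among
    its terms. *)
Lemma tnth_config_of_gaps s k :
  tnth (config_of_gaps (gaps s)) k = (sort <=%R s)`_k - (sort <=%R s)`_0.
Proof.
rewrite tnth_mktuple; case: k => k /= kN; elim: k kN => [|k ih] kN.
  by rewrite big_pred0// subrr.
rewrite (bigD1 (Ordinal (ltnW kN)))//= tnth_mktuple/= kN.
rewrite (eq_bigl (fun i : 'I_N => (i < k)%N)) ?ih 1?ltnW//; first by ring.
by move=> i; rewrite ltnS [in RHS]ltn_neqAle andbC.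
Qed.

Lemma config_of_gaps_perm s : exists (a : R) (sg : {perm 'I_N}),
  forall k, tnth (config_of_gaps (gaps s)) k = tnth s (sg k) - a.
Proof.
have /tuple_permP[sg ss] : perm_eq (sort <=%R s) s.
  by rewrite (perm_sort <=%R s).
exists (sort <=%R s)`_0, sg => k; rewrite tnth_config_of_gaps; congr (_ - _).
by rewrite ss -tnth_nth tnth_mktuple.
Qed.

Lemma config_of_gaps_itv s k : (forall i, 0 <= tnth s i <= 1) ->
  0 <= tnth (config_of_gaps (gaps s)) k <= 1.
Proof.
move=> s01; rewrite tnth_config_of_gaps.
have sz : size (sort <=%R s) = N by rewrite size_sort size_tuple.
have t01 i : (i < N)%N -> 0 <= (sort <=%R s)`_i <= 1.
  move=> iN; have : (sort <=%R s)`_i \in sort <=%R s by rewrite mem_nth// sz.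
  by rewrite mem_sort => /tnthP[j ->].
have N0 : (0 < N)%N by exact: leq_ltn_trans (ltn_ord k).
have /andP[t0 _] := t01 _ N0; have /andP[_ tk1] := t01 _ (ltn_ord k).
have : (sort <=%R s)`_0 <= (sort <=%R s)`_k.
  by apply: (sorted_leq_nth (@le_trans _ _) (@le_refl _ _)) => //;
    rewrite ?inE ?sz ?ltn_ord//; exact: sort_sorted le_total _.
lra.
Qed.

(** This is [drift_ge] for the configuration rebuilt from the gaps. Its integrals are those of s,
    because it differs from s by a rotation and a relabelling. *)
Lemma deltaV_ge s : (1 < N)%N -> (forall i, 0 <= tnth s i <= 1) ->
  \sum_(i < N)
    (\int[U]_z next_dist (others s i) z ^+ 2 - \int[U]_z next_dist s z ^+ 2 -
     4 / 7 * (\int[U]_z next_dist (others s i) z ^+ 3 -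
              \int[U]_z next_dist s z ^+ 3)) - \int[U]_z next_dist s z ^+ 2
  <= deltaV (gaps s).
Proof.
move=> N1 s01; set c := config_of_gaps (gaps s).
have [a [sg cE]] := config_of_gaps_perm s; rewrite -/c in cE.
have nE n : \int[U]_z next_dist s z ^+ n = \int[U]_z next_dist c z ^+ n.
  rewrite -(integral_next_dist_shift n s a); apply: eq_prob_integral => z.
  congr (_ ^+ _); apply: eq_mem_next_dist => x; apply/mapP/tnthP.
    by move=> [_ /tnthP[i ->] ->]; exists (sg^-1 i)%g; rewrite cE permKV.
  by move=> [k ->]; exists (tnth s (sg k)); rewrite ?mem_tnth.
have oE n k : \int[U]_z next_dist (others s (sg k)) z ^+ n =
    \int[U]_z next_dist (others c k) z ^+ n.
  rewrite -(integral_next_dist_shift n _ a); apply: eq_prob_integral => z.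
  congr (_ ^+ _); apply: eq_mem_next_dist => x; apply/mapP/othersP.
    move=> [_ /othersP[i isg ->] ->]; exists (sg^-1 i)%g; rewrite ?cE ?permKV//.
    by apply: contra_neq isg => <-; rewrite permKV.
  move=> [j jk ->]; exists (tnth s (sg j)); rewrite ?cE//.
  by apply/othersP; exists (sg j) => //; rewrite (inj_eq perm_inj).
(* Removing driver k of c corresponds to removing driver [sg k] of s. *)
rewrite !nE (reindex_inj (@perm_inj _ sg))/=.
under eq_bigr do rewrite !oE.
have -> : deltaV (gaps s) = \int[(U \x U)%E]_uw
    (V (gaps (step c uw.1 uw.2)) - 2 * \int[U]_z next_dist c z).
  rewrite /deltaV V_gaps_integral ?(ltnW N1)//.
  by rewrite -[\int[U]_z next_dist s z]/(\int[U]_z next_dist s z ^+ 1) nE.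
apply: drift_ge => // k; exact: config_of_gaps_itv.
Qed.

End drift_of_gap_vector.

(** * Independent uniform drivers *)

Lemma measurable_set_ler d (T : measurableType d) (R : realType)
    (f g : T -> R) : measurable_fun setT f -> measurable_fun setT g ->
  measurable [set t | f t <= g t].
Proof.
move=> mf mg; rewrite -[X in measurable X]setTI.
exact: (measurable_fun_ler mf mg measurableT (Y := [set true])).
Qed.

(* Layer cake: M ^+ k.+1 = 1 - k.+1 * \int 1_(M <= x < 1) x ^+ k. *)
Lemma moment_of_power_law d (T : measurableType d) (R : realType)
    (P : probability T R) (M : T -> R) (K k : nat) :
  measurable_fun setT M -> (forall t, 0 <= M t <= 1) ->
  (forall x, 0 <= x < 1 -> P [set t | M t <= x] = (x ^+ K)%:E) ->
  \int[P]_t M t ^+ k.+1 = K%:R / (K + k.+1)%:R.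
Proof.
move=> mM M01 PM; set U := unif01 R.
pose E : set (T * measurableTypeR R) := [set tx | M tx.1 <= tx.2].
pose mono (a : R) (x : measurableTypeR R) : R := \1_(`[0, a[%classic) x * x ^+ k.
pose g (t : T) (x : measurableTypeR R) : R := mono 1 x * \1_E (t, x).
have mE : measurable E.
  apply: measurable_set_ler; last exact: measurable_snd.
  exact: (measurableT_comp mM measurable_fst).
have bmono a : a <= 1 -> bounded_measurable (mono a).
  exact: bounded_measurable_indic_monomial.
have bg : bounded_measurable (fun tx => g tx.1 tx.2).
  apply: bounded_measurableM.
    by apply: (bounded_measurable_comp _ (bmono 1 _)) => //; exact: measurable_snd.
  rewrite [X in bounded_measurable X](_ : _ = \1_E); last first.
    by apply/funext => -[].
  exact: bounded_measurable_indic.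
have MgE t : M t ^+ k.+1 = 1 - k.+1%:R * \int[U]_x g t x.
  have -> : \int[U]_x g t x = \int[U]_x (mono 1 x - mono (M t) x).
    apply: eq_prob_integral => x; rewrite /g /mono.
    have indI (a : R) : \1_(`[0, a[%classic) x = (0 <= x < a)%R%:R :> R.
      rewrite indicE; case: (boolP (x \in _)); first by rewrite inE/= in_itv/= => ->.
      by rewrite notin_setE/= in_itv/= => /negP/negbTE ->.
    have indE : \1_E (t, x) = (M t <= x)%R%:R :> R.
      rewrite indicE; case: (boolP (_ \in _)); first by rewrite inE/E/= => ->.
      by rewrite notin_setE/E/= => /negP/negbTE ->.
    rewrite !indI indE leNgt; have /andP[M0 M1] := M01 t.
    have [x0|x0] := leP 0 x; last by rewrite !mul0r subrr.
    have [xM|xM] /= := ltP x (M t); last by rewrite mul0r mulr1 subr0.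
    by rewrite (lt_le_trans xM M1) mulr0 subrr.
  have /andP[_ M1] := M01 t.
  rewrite prob_integralB; [|exact: bmono..].
  by rewrite !unif01_integral_monomial ?ler01 ?lexx// expr1n; field.
under eq_Rintegral do rewrite MgE.
have bI := bounded_measurable_integral P U bg.
rewrite prob_integralB; first last.
- exact: bounded_measurableZ.
- exact: bounded_measurable_cst.
rewrite prob_integral_cst prob_integralZ// (prob_integral_swap P U bg).
have -> : \int[U]_x \int[P]_t g t x = \int[U]_x (\1_(`[0, 1[%classic) x * x ^+ (k + K)).
  apply: eq_prob_integral => x; rewrite /g.
  have mEx : measurable [set t | M t <= x] by exact: measurable_set_ler.
  have sE t : \1_E (t, x) = \1_[set t | M t <= x] t :> R.
    by rewrite !indicE; congr ((_ : bool)%:R); apply/idP/idP; rewrite !inE.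
  under eq_Rintegral do rewrite sE.
  rewrite prob_integralZ; last exact: bounded_measurable_indic.
  rewrite prob_integral_indic// /mono indicE.
  case: (boolP (x \in _)); rewrite ?mul0r// inE/= in_itv/= => x01.
  by rewrite PM//= !mul1r exprD.
rewrite unif01_integral_monomial ?ler01 ?lexx// expr1n div1r addnC -addnS.
have Kk : (K + k.+1)%:R != 0 :> R by rewrite pnatr_eq0 addnS.
apply: (mulIf Kk); rewrite mulfVK// mulrBl mul1r -mulrA mulVf// mulr1 natrD.
by rewrite addrK.
Qed.

Section independent_uniform_drivers.
Context (R : realType) (N : nat) (d : measure_display) (T : measurableType d).
Context (P : probability T R) (S : 'I_N -> {RV P >-> R}).
Hypothesis S_uniform : forall (i : 'I_N) (A : set R), measurable A ->
  distribution P (S i) A = unif01 R A.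
Hypothesis S_indep : mutually_independent S.
Local Notation U := (unif01 R).
Implicit Types (J : {set 'I_N}) (z : R).

Lemma prob_all_in J (A : set R) : measurable A ->
  P [set t | forall j, j \in J -> A (S j t)] = (\prod_(j in J) U A)%E.
Proof.
move=> mA; rewrite -(eq_bigr _ (fun j _ => S_uniform j mA)).
by rewrite -(@S_indep J (fun=> A)).
Qed.

Lemma prob_all_positions :
  P [set t | forall i, `[0, 1]%classic (S i t)] = 1%E.
Proof.
have := @prob_all_in [set: 'I_N] `[0, 1]%classic (measurable_itv _).
rewrite (unif01_itv true false)// subr0 big1// => <-.
by congr (P _); apply/seteqP; split=> t h i; [move=> _|]; apply: h; rewrite ?inE.
Qed.

(** A set J of drivers covers at once the full configuration and the configurations with one driver
    removed. *)
Definition next_dist_of J (t : T) z : R :=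
  next_dist [seq S j t | j <- enum J] z.

Lemma bounded_measurable_next_dist_of J :
  bounded_measurable (fun tz : T * measurableTypeR R => next_dist_of J tz.1 tz.2).
Proof.
rewrite /next_dist_of /next_dist; under eq_fun do rewrite -map_comp.
apply: bounded_measurable_minseq => j; apply: bounded_measurable_fpart.
by apply: measurable_funB => //; exact: measurableT_comp.
Qed.

(** The next driver is at distance at least 1 - x exactly when each driver of J is, an event of
    probability x for each. The complement to 1 thus has the law of a maximum of independent uniform
    variables, as used by [moment_of_power_law]. *)
Lemma prob_next_dist_of J z x : 0 <= x < 1 ->
  P [set t | 1 - next_dist_of J t z <= x] = (x ^+ #|J|)%:E.
Proof.
move=> /andP[x0 x1]; pose A := [set v : R | 1 - x <= fpart (v - z)].
have mA : measurable A.
  apply: measurable_set_ler => //.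
  by apply: measurableT_comp; [exact: measurable_fpart|exact: measurable_funB].
have UA : U A = x%:E.
  have -> : A = (fun v => fpart (- z + v)) @^-1` `[1 - x, +oo[%classic.
    by apply/seteqP; split=> v; rewrite /A/= in_itv/= andbT [- z + v]addrC.
  rewrite (measure_preserving_rotation (- z)).2// unif01_setI_co01//.
  transitivity (U `[1 - x, 1[%classic).
    congr (U _); apply/seteqP; split => y /=; rewrite !in_itv/=; lra.
  by rewrite unif01_itv; try congr EFin; lra.
transitivity (P [set t | forall j, j \in J -> A (S j t)]).
  congr (P _); apply/seteqP; split => t /=.
    move=> h j jJ; have : 1 - x <= next_dist_of J t z by lra.
    move=> /le_trans; apply; apply: minseq_le; rewrite -map_comp.
    by apply/mapP; exists j; rewrite // mem_enum.
  move=> h; rewrite lerBlDr -lerBlDl le_minseq lerBlDr lerDl x0/=.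
  by rewrite -map_comp; apply/allP => y /mapP[j]; rewrite mem_enum => /h Aj ->.
rewrite prob_all_in// (eq_bigr (fun=> x%:E)) => [|j _]; last exact: UA.
by rewrite prodEFin prodr_const.
Qed.

(** The powers of 1 - M are expanded, where M has k-th moment |J| / (|J| + k). *)
Lemma moment_next_dist_of J z :
  \int[P]_t next_dist_of J t z ^+ 2 = 2 / ((#|J|%:R + 1) * (#|J|%:R + 2)) /\
  \int[P]_t next_dist_of J t z ^+ 3 =
    6 / ((#|J|%:R + 1) * (#|J|%:R + 2) * (#|J|%:R + 3)).
Proof.
have bm : bounded_measurable (next_dist_of J ^~ z).
  exact: (bounded_measurable_section2 (bounded_measurable_next_dist_of J) z).
pose M t := 1 - next_dist_of J t z.
have bM : bounded_measurable M.
  exact: bounded_measurableB (bounded_measurable_cst _ _) bm.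
have ME k : \int[P]_t M t ^+ k.+1 = #|J|%:R / (#|J| + k.+1)%:R.
  apply: moment_of_power_law; first exact: bM.1.
    by move=> t; rewrite subr_ge0 next_dist_le1 lerBlDr lerDl next_dist_ge0.
  by move=> x; exact: prob_next_dist_of.
have bMk k : bounded_measurable (fun t => M t ^+ k) by exact: bounded_measurableX.
have bZ c k : bounded_measurable (fun t => c * M t ^+ k) by exact: bounded_measurableZ.
have b1 : bounded_measurable (fun _ : T => 1 : R) by exact: bounded_measurable_cst.
have J0 k : #|J|%:R + k.+1%:R != 0 :> R by rewrite -natrD pnatr_eq0 addnS.
have := (J0 0, J0 1, J0 2)%N => -[[J1 J2] J3].
split.
  transitivity (\int[P]_t (1 + ((-2) * M t ^+ 1 + 1 * M t ^+ 2))).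
    by apply: eq_prob_integral => t; rewrite /M; ring.
  rewrite prob_integralD//; last exact: bounded_measurableD.
  rewrite prob_integralD// !prob_integralZ// prob_integral_cst !ME !natrD.
  by field; rewrite J1 J2.
transitivity (\int[P]_t (1 + ((-3) * M t ^+ 1 + (3 * M t ^+ 2 + (-1) * M t ^+ 3)))).
  by apply: eq_prob_integral => t; rewrite /M; ring.
rewrite prob_integralD//; last first.
  by apply: bounded_measurableD => //; exact: bounded_measurableD.
rewrite prob_integralD//; last exact: bounded_measurableD.
rewrite prob_integralD// !prob_integralZ// prob_integral_cst !ME !natrD.
by field; rewrite J1 J2 J3.
Qed.

End independent_uniform_drivers.

(** * Positivity of the expected drift *)

Theorem theorem2 (R : realType) (N : nat) (hN : (2 < N)%N)
    (d : measure_display) (T : measurableType d) (P : probability T R)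
    (S : 'I_N -> {RV P >-> R})
    (S_uniform : forall (i : 'I_N) (A : set R), measurable A ->
       distribution P (S i) A = unif01 R A)
    (S_indep : mutually_independent S) :
  (0 < 'E_P[fun t : T => deltaV (gaps [tuple S i t | i < N])])%E.
Proof.
pose U := unif01 R.
pose m n J t := \int[U]_z next_dist_of S J t z ^+ n.
pose but i : {set 'I_N} := finset.finset (fun j => j != i).
pose all : {set 'I_N} := finset.finset predT.
(* The lower bound of [deltaV_ge] as a function of the outcome; it is bounded and measurable by
   construction. *)
pose low t := \sum_(i < N) (m 2 (but i) t - m 2 all t -
  4 / 7 * (m 3 (but i) t - m 3 all t)) - m 2 all t.
have bX n J : bounded_measurable (fun tz : T * measurableTypeR R =>
    next_dist_of S J tz.1 tz.2 ^+ n).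
  exact/bounded_measurableX/bounded_measurable_next_dist_of.
have bm n J : bounded_measurable (m n J).
  exact: (bounded_measurable_integral P U (bX n J)).
have bterm i : bounded_measurable (fun t => m 2 (but i) t - m 2 all t -
    4 / 7 * (m 3 (but i) t - m 3 all t)).
  apply: bounded_measurableB; first exact: bounded_measurableB.
  exact/bounded_measurableZ/bounded_measurableB.
have bsum := bounded_measurable_sum (index_enum _) xpredT bterm.
have blow : bounded_measurable low by exact: bounded_measurableB.
(* Exchanging the integrals over the outcome and over z leaves a moment at fixed z, whose value does
   not depend on z. *)
have mE n J e : (forall z, \int[P]_t next_dist_of S J t z ^+ n = e) ->
    \int[P]_t m n J t = e.
  move=> eE; rewrite (prob_integral_swap P U (bX n J)).
  by under eq_Rintegral do rewrite eE; rewrite prob_integral_cst.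
have m2 J := mE _ _ _ (fun z => (moment_next_dist_of S_uniform S_indep J z).1).
have m3 J := mE _ _ _ (fun z => (moment_next_dist_of S_uniform S_indep J z).2).
have low_gt0 : 0 < \int[P]_t low t.
  rewrite prob_integralB// prob_integral_sum//.
  have Nall : #|all| = N by rewrite cardsE card_ord.
  rewrite m2 Nall.
  have Nbut i : #|but i| = N.-1.
    by rewrite cardsE; apply: etrans (cardC1 i) _; rewrite card_ord.
  have bB n i : bounded_measurable (fun t => m n (but i) t - m n all t).
    exact: bounded_measurableB.
  under eq_bigr => i _.
    rewrite prob_integralB//; last exact: bounded_measurableZ.
    rewrite prob_integralZ// !prob_integralB// !(m2, m3) Nbut Nall.
    over.
  rewrite sumr_const card_ord -mulr_natl.
  have N2 : 3 <= N%:R :> R by rewrite ler_nat.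
  have -> : N.-1%:R = N%:R - 1 :> R by rewrite -subn1 natrB// (ltn_trans _ hN).
  set x : R := N%:R in N2 *.
  (* The numerator is at least 12, as x >= 3. *)
  rewrite (_ : _ - _ = (14 * x - 30) / (7 * (x + 1) * (x + 2) * (x + 3))).
    by rewrite divr_gt0 ?mulr_gt0//; lra.
  field.
  by repeat (apply/andP; split); rewrite gt_eqF//; lra.
rewrite unlock.
have mA : measurable [set t | forall i, `[0, 1]%classic (S i t)].
  rewrite (_ : [set t | _] = \bigcap_(i in [set: 'I_N]) (S i @^-1` `[0, 1])).
    apply: fin_bigcap_measurable => // i _.
    by rewrite -[X in measurable X]setTI; exact: measurable_funPT.
  by apply/seteqP; split => t h i; [move=> _|]; exact: h.
(* The expectation is an extended integral; the minorant [low], valid on the almost sure event that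
   all positions lie in [0, 1], gives its sign. *)
apply: lt_le_trans (prob_integral_lower mA (prob_all_positions S_uniform S_indep) blow _).
  by rewrite lte_fin.
move=> t /= t01; set s := [tuple S i t | i < N].
have s01 i : 0 <= tnth s i <= 1.
  by have := t01 i; rewrite tnth_mktuple /= in_itv.
apply: le_trans (deltaV_ge (ltnW hN) s01).
have mall n : m n all t = \int[U]_z next_dist s z ^+ n.
  apply: eq_prob_integral => z; congr (_ ^+ _); apply: eq_mem_next_dist => x.
  apply/mapP/tnthP => [[i _ ->]|[i ->]]; exists i; rewrite ?tnth_mktuple//.
  by rewrite mem_enum finset.inE.
have mbut n i : m n (but i) t = \int[U]_z next_dist (others s i) z ^+ n.
  apply: eq_prob_integral => z; congr (_ ^+ _); apply: eq_mem_next_dist => x.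
  apply/mapP/othersP => [[j]|[j ji ->]].
    by rewrite mem_enum finset.inE => ji ->; exists j; rewrite ?tnth_mktuple.
  by exists j; rewrite ?tnth_mktuple// mem_enum finset.inE.
rewrite /low mall; under eq_bigr do rewrite !mall !mbut.
by rewrite lexx.
Qed.
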